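(* Let $\Omega$ be a quasi-product with connected quasi-factors $\Lambda$ and $\Gamma$. Then $\Omega\cong\Lambda\times\Gamma$ (as $(k_1+k_2)$-graphs) if and only if $\Lambda$ and $\Gamma$ are both relaxed stable quasi-factors of $\Omega$.
   Context: Conventions: $\mathbb N=\{0,1,2,\dots\}$ and $e_1,\dots,e_k$ is the standard basis of $\mathbb N^k$. A $k$-graph is a countable category $\Lambda$ (objects identified with identity morphisms) with a functor $d:\Lambda\to\mathbb N^k$ such that whenever $d(\lambda)=m+n$ there are unique $\mu,\nu\in\Lambda$ with $\lambda=\mu\nu$, $d(\mu)=m$, $d(\nu)=n$. Write $\Lambda^0=d^{-1}(0)$, and $r(\lambda),s(\lambda)$ for range and source; $\mu\nu$ is defined when $s(\mu)=r(\nu)$. Isomorphisms of $k$-graphs are bijective degree-preserving functors. The one-skeleton $G(\Lambda)$ is the edge-colored directed graph with vertex set $\Lambda^0$, edge set $\{\lambda: d(\lambda)\in\{e_1,\dots,e_k\}\}$, source and range inherited from $\Lambda$, and $d(e)$ as the color of $e$. $\Lambda$ is connected if the undirected graph underlying $G(\Lambda)$ is connected. Isomorphisms of edge-colored directed graphs preserve source, range and color. For a directed graph $G$, $G^*$ is its category of finite paths $p_1\cdots p_n$ with $s(p_i)=r(p_{i+1})$ (vertices are paths of length $0$). The color order of $p_1\cdots p_n$ is $(d(p_1),\dots,d(p_n))$. Two paths in $G(\Lambda)^*$ are equivalent if they have the same composite in $\Lambda$; $[p]$ denotes the class (composite) of $p$. By the factorization property, for each path $p$ and each permutation of its color order there is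 exactly one path equivalent to $p$ with that color order. If $\Lambda$ is a $k_1$-graph and $\Gamma$ a $k_2$-graph, $\Lambda\times\Gamma$ is the product $(k_1+k_2)$-graph with degree $(d_\Lambda,d_\Gamma)$. Its one-skeleton has vertices $\Lambda^0\times\Gamma^0$ and edges $(e,v)$ ($e$ an edge of $G(\Lambda)$, $v\in\Gamma^0$; colored as $e$) and $(x,f)$ ($x\in\Lambda^0$, $f$ an edge of $G(\Gamma)$; colored $e_{k_1+j}$ if $f$ has color $e_j$), with source and range computed coordinatewise. A $(k_1+k_2)$-graph $\Omega$ is a quasi-product with quasi-factors $\Lambda$ (a $k_1$-graph) and $\Gamma$ (a $k_2$-graph) if: (i) $G(\Omega)\cong G(\Lambda\times\Gamma)$; (ii) there are injective functors $\psi_1:\Lambda\to\Omega$ and $\psi_2:\Gamma\to\Omega$; (iii) $d_\Lambda=\pi_1 d_\Omega\psi_1$ and $d_\Gamma=\pi_2d_\Omega\psi_2$, where $\pi_i:\mathbb N^{k_1}\times\mathbb N^{k_2}\to\mathbb N^{k_i}$ are the projections. One fixes the identification $G(\Omega)=G(\Lambda\times\Gamma)$ and labels edges and paths of $G(\Omega)$ accordingly. Put $\Omega_1=d^{-1}(\mathbb N^{k_1}\times\{0\})$, $\Omega_2=d^{-1}(\{0\}\times\mathbb N^{k_2})$. Then $\Omega_1=\bigsqcup_{w\in\Gamma^0}\Omega_1^w\times\{w\}$ and $\Omega_2=\bigsqcup_{x\in\Lambda^0}\{x\}\times\Omega_2^x$, where $\Omega_1^w\times\{w\}$ (resp. $\{x\}\times\Omega_2^x$)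 is the $k_1$-graph (resp. $k_2$-graph) of all elements of $\Omega$ represented by paths in $G(\Lambda)\times\{w\}$ (resp. $\{x\}\times G(\Gamma)$). For $p\in G(\Lambda)^*$, $([p],w)$ denotes the element of $\Omega_1^w\times\{w\}$ represented by the path $(p,w)$, and $[p]_w\in\Omega_1^w$ the corresponding element; similarly $(x,[q])$ and $[q]_x\in\Omega_2^x$ for $q\in G(\Gamma)^*$. Conditions (ii)-(iii) in the definition of quasi-product are understood to guarantee that there are $w_0\in\Gamma^0$ and $x_0\in\Lambda^0$ with $\Omega_1^{w_0}\cong\Lambda$ and $\Omega_2^{x_0}\cong\Gamma$ as $k_1$- and $k_2$-graphs, respectively. Given $p\in G(\Lambda)^*$ and $q\in G(\Gamma)^*$, the element $([p],r(q))(s(p),[q])\in\Omega$ factors uniquely as $\beta\alpha$ with $\beta\in\Omega_2$, $\alpha\in\Omega_1$. Here $d(\beta)=d(s(p),[q])$, $d(\alpha)=d([p],r(q))$, $\beta\in\{r(p)\}\times\Omega_2^{r(p)}$ and $\alpha\in\Omega_1^{s(q)}\times\{s(q)\}$. Define $p_\vartriangleright(q)\in G(\Gamma)^*$ to be the unique path with the same color order as $q$ such that $(r(p),[p_\vartriangleright(q)])=\beta$, and $q_\vartriangleleft(p)\in G(\Lambda)^*$ to be the unique path with the same color order as $p$ such that $([q_\vartriangleleft(p)],s(q))=\alpha$. These maps preserve color order, source and range, and induce well-defined maps $\widehat p_\vartriangleright:\Omega_2^{s(p)}\to\Omega_2^{r(p)}$, $[q]_{s(p)}\mapsto[p_\vartriangleright(q)]_{r(p)}$,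 and $\widehat q_\vartriangleleft:\Omega_1^{r(q)}\to\Omega_1^{s(q)}$, $[p]_{r(q)}\mapsto[q_\vartriangleleft(p)]_{s(q)}$. For a directed graph $G$, $\widehat G$ is the directed graph with the same vertices and with edges $\{e_+,e_-:e\text{ an edge of }G\}$, where $s(e_+)=s(e)=r(e_-)$ and $r(e_+)=r(e)=s(e_-)$; write $\widehat G(\Lambda)=\widehat{G(\Lambda)}$. When all $\widehat e_\vartriangleright$ ($e$ an edge of $G(\Lambda)$) are bijective, for a path $\xi=e^1_\pm\cdots e^n_\pm\in\widehat G(\Lambda)^*$ set $\widehat\xi_\vartriangleright=(\widehat{e^1}_\vartriangleright)^{\pm1}\circ\cdots\circ(\widehat{e^n}_\vartriangleright)^{\pm1}:\Omega_2^{s(\xi)}\to\Omega_2^{r(\xi)}$. When all $\widehat f_\vartriangleleft$ ($f$ an edge of $G(\Gamma)$) are bijective, for a path $\zeta=f^1_\pm\cdots f^n_\pm\in\widehat G(\Gamma)^*$ set $\widehat\zeta_\vartriangleleft=(\widehat{f^n}_\vartriangleleft)^{\pm1}\circ\cdots\circ(\widehat{f^1}_\vartriangleleft)^{\pm1}:\Omega_1^{r(\zeta)}\to\Omega_1^{s(\zeta)}$. (Both are identities for paths of length $0$.) For $\Lambda$ connected, $\Gamma$ is a relaxed stable quasi-factor of $\Omega$ if $\widehat p_\vartriangleright$ is bijective for each $p\in G(\Lambda)^*$ and $\widehat\xi_\vartriangleright=\widehat{\xi'}_\vartriangleright$ for all $\xi,\xi'\in\widehat G(\Lambda)^*$ with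 $r(\xi)=r(\xi')$, $s(\xi)=s(\xi')$. Symmetrically, for $\Gamma$ connected, $\Lambda$ is a relaxed stable quasi-factor of $\Omega$ if $\widehat q_\vartriangleleft$ is bijective for each $q\in G(\Gamma)^*$ and $\widehat\zeta_\vartriangleleft=\widehat{\zeta'}_\vartriangleleft$ for all $\zeta,\zeta'\in\widehat G(\Gamma)^*$ with $r(\zeta)=r(\zeta')$, $s(\zeta)=s(\zeta')$. *)

(* Defs.v *)
From mathcomp Require Import all_boot all_algebra.
From Stdlib Require Eqdep_dec.
From mathcomp Require Import boolp.

Set Implicit Arguments.
Unset Strict Implicit.
Unset Printing Implicit Defensive.

Import GRing.Theory.
Local Open Scope ring_scope.

(* The monoid N^k is 'rV[nat]_k, e_i is delta_mx 0 i, and the projections of  *)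
(* N^(k1 + k2) onto N^k1 and N^k2 are lsubmx and rsubmx.                      *)

(* A small category is given by objects and arrows, an object v being         *)
(* identified with the arrow kid v. The value of kcomp mu nu is meaningful    *)
(* only if ks mu = kr nu. By kdeg0 below, the arrows of degree 0 are exactly  *)
(* the identities, so that kobj is the vertex set of the k-graph.             *)
Record kgraph (k : nat) := KGraph {
  kobj : countType;
  kmor : countType;
  kr : kmor -> kobj;
  ks : kmor -> kobj;
  kid : kobj -> kmor;
  kcomp : kmor -> kmor -> kmor;
  kdeg : kmor -> 'rV[nat]_k;
  kr_id : forall v, kr (kid v) = v;
  ks_id : forall v, ks (kid v) = v;
  kr_comp : forall mu nu, ks mu = kr nu -> kr (kcomp mu nu) = kr mu;
  ks_comp : forall mu nu, ks mu = kr nu -> ks (kcomp mu nu) = ks nu;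
  kcomp1m : forall mu, kcomp (kid (kr mu)) mu = mu;
  kcompm1 : forall mu, kcomp mu (kid (ks mu)) = mu;
  kcompA : forall la mu nu, ks la = kr mu -> ks mu = kr nu ->
    kcomp la (kcomp mu nu) = kcomp (kcomp la mu) nu;
  kdeg_id : forall v, kdeg (kid v) = 0;
  kdeg_comp : forall mu nu, ks mu = kr nu ->
    kdeg (kcomp mu nu) = kdeg mu + kdeg nu;
  kfact : forall la m n, kdeg la = m + n ->
    exists! munu : kmor * kmor,
      [/\ ks munu.1 = kr munu.2, la = kcomp munu.1 munu.2,
          kdeg munu.1 = m & kdeg munu.2 = n]
}.

Record kfunctor k l (L : kgraph k) (O : kgraph l) := KFunctor {
  fobj : kobj L -> kobj O;
  fmor : kmor L -> kmor O;
  fmor_r : forall la, kr (fmor la) = fobj (kr la);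
  fmor_s : forall la, ks (fmor la) = fobj (ks la);
  fmor_id : forall v, fmor (kid v) = kid (fobj v);
  fmor_comp : forall mu nu, ks mu = kr nu ->
    fmor (kcomp mu nu) = kcomp (fmor mu) (fmor nu)
}.

Definition kiso k (L O : kgraph k) : Prop :=
  exists F : kfunctor L O,
    [/\ bijective (fobj F), bijective (fmor F) &
        forall la, kdeg (fmor F la) = kdeg la].

Record digraph := Digraph {
  gvert : Type;
  gedge : Type;
  grng : gedge -> gvert;
  gsrc : gedge -> gvert
}.

Record cgraph (C : Type) := CGraph {
  cg_digraph :> digraph;
  gcol : gedge cg_digraph -> C
}.

Record cgraph_iso C (G H : cgraph C) := CGraphIso {
  iso_v : gvert G -> gvert H;
  iso_e : gedge G -> gedge H;
  iso_v_bij : bijective iso_v;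
  iso_e_bij : bijective iso_e;
  iso_r : forall e, grng (iso_e e) = iso_v (grng e);
  iso_s : forall e, gsrc (iso_e e) = iso_v (gsrc e);
  iso_col : forall e, gcol (iso_e e) = gcol e
}.

Definition edge_of k (L : kgraph k) : Type :=
  {e : kmor L | [exists i : 'I_k, kdeg e == delta_mx 0 i]}.

Definition skeleton k (L : kgraph k) : cgraph 'rV[nat]_k :=
  @CGraph _
    (@Digraph (kobj L) (edge_of L) (fun e => kr (val e)) (fun e => ks (val e)))
    (fun e => kdeg (val e)).

(* gpath x y is the type of paths with range x and source y. *)
Inductive gpath (G : digraph) : gvert G -> gvert G -> Type :=
| gnil x : gpath x x
| gcons (e : gedge G) y (p : gpath (gsrc e) y) : gpath (grng e) y.

Arguments gnil {G} x.
Arguments gcons {G} e {y} p.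

Definition gpath1 (G : digraph) (e : gedge G) : gpath (grng e) (gsrc e) :=
  gcons e (gnil (gsrc e)).

Fixpoint color_order C (G : cgraph C) (x y : gvert G) (p : gpath x y) : seq C :=
  match p with
  | gnil _ => [::]
  | gcons e _ q => gcol e :: color_order q
  end.

(* The edges e_+ and e_- are (e, true) and (e, false). *)
Definition double (G : digraph) : digraph :=
  @Digraph (gvert G) (gedge G * bool)
    (fun eb => if eb.2 then grng eb.1 else gsrc eb.1)
    (fun eb => if eb.2 then gsrc eb.1 else grng eb.1).

Definition connected (G : digraph) : Prop :=
  forall x y : gvert G, inhabited (@gpath (double G) x y).

(******************************************************************************)

Section KGraphTheory.
Variables (k : nat) (L : kgraph k).
Implicit Types (la mu nu : kmor L).

Definition kfactor la m n (h : kdeg la = m + n) : kmor L * kmor L :=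
  sval (cid (kfact h)).

Lemma kfactorP la m n (h : kdeg la = m + n) :
  [/\ ks (kfactor h).1 = kr (kfactor h).2,
      la = kcomp (kfactor h).1 (kfactor h).2,
      kdeg (kfactor h).1 = m & kdeg (kfactor h).2 = n].
Proof. by rewrite /kfactor; case: cid => /= ? []. Qed.

Lemma kcompI mu nu mu' nu' : ks mu = kr nu -> ks mu' = kr nu' ->
  kdeg mu = kdeg mu' -> kdeg nu = kdeg nu' ->
  kcomp mu nu = kcomp mu' nu' -> mu = mu' /\ nu = nu'.
Proof.
move=> c c' dmu dnu e.
have [[a b] [_ u]] := kfact (kdeg_comp c).
have := u (mu, nu); have := u (mu', nu') => /= u1 u2.
have /u1 : [/\ ks mu' = kr nu', kcomp mu nu = kcomp mu' nu',
  kdeg mu' = kdeg mu & kdeg nu' = kdeg nu] by [].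
have /u2 -> : [/\ ks mu = kr nu, kcomp mu nu = kcomp mu nu,
  kdeg mu = kdeg mu & kdeg nu = kdeg nu] by [].
by case=> -> ->.
Qed.

Lemma kdeg0 la : kdeg la = 0 <-> la = kid (kr la).
Proof.
split=> [h|->]; last exact: kdeg_id.
by case: (@kcompI (kid (kr la)) la la (kid (ks la)));
  rewrite ?kr_id ?ks_id ?kdeg_id ?h ?kcomp1m ?kcompm1.
Qed.

End KGraphTheory.

(******************************************************************************)

Section Product.
Variables (k1 k2 : nat) (L : kgraph k1) (G : kgraph k2).

Definition prod_mor : countType := (kmor L * kmor G)%type.
Definition prod_obj : countType := (kobj L * kobj G)%type.
Definition prod_r (la : prod_mor) : prod_obj := (kr la.1, kr la.2).
Definition prod_s (la : prod_mor) : prod_obj := (ks la.1, ks la.2).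
Definition prod_id (v : prod_obj) : prod_mor := (kid v.1, kid v.2).
Definition prod_comp (mu nu : prod_mor) : prod_mor :=
  (kcomp mu.1 nu.1, kcomp mu.2 nu.2).
Definition prod_deg (la : prod_mor) : 'rV[nat]_(k1 + k2) :=
  row_mx (kdeg la.1) (kdeg la.2).

Lemma prod_fact la m n : prod_deg la = m + n ->
  exists! munu : prod_mor * prod_mor,
    [/\ prod_s munu.1 = prod_r munu.2, la = prod_comp munu.1 munu.2,
        prod_deg munu.1 = m & prod_deg munu.2 = n].
Proof.
case: la => l g; rewrite /prod_deg /= -(hsubmxK m) -(hsubmxK n) add_row_mx.
case/eq_row_mx => hl hg.
have [sl el dl1 dl2] := kfactorP hl; have [sg eg dg1 dg2] := kfactorP hg.
exists (((kfactor hl).1, (kfactor hg).1), ((kfactor hl).2, (kfactor hg).2)).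
split=> /=.
  split; rewrite /prod_s /prod_r /prod_comp /= ?sl ?sg -?el -?eg //.
    by rewrite dl1 dg1.
  by rewrite dl2 dg2.
case=> [[a b] [a' b']] /= [[s1 s2] [e1 e2] /eq_row_mx[d1 d2] /eq_row_mx[d3 d4]].
case: (kcompI sl s1 _ _ _); rewrite ?dl1 ?dl2 -?el //.
case: (kcompI sg s2 _ _ _); rewrite ?dg1 ?dg2 -?eg //.
by move=> -> -> -> ->.
Qed.

Definition kprod : kgraph (k1 + k2).
Proof.
apply: (@KGraph _ prod_obj prod_mor prod_r prod_s prod_id prod_comp prod_deg).
- by case=> v w; rewrite /prod_r /= !kr_id.
- by case=> v w; rewrite /prod_s /= !ks_id.
- by case=> a b [c d] [h1 h2]; rewrite /prod_r /= !kr_comp.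
- by case=> a b [c d] [h1 h2]; rewrite /prod_s /= !ks_comp.
- by case=> a b; rewrite /prod_comp /= !kcomp1m.
- by case=> a b; rewrite /prod_comp /= !kcompm1.
- by case=> a b [c d] [e f] [h1 h2] [h3 h4]; rewrite /prod_comp /= !kcompA.
- by case=> a b; rewrite /prod_deg /= !kdeg_id row_mx0.
- by case=> a b [c d] [h1 h2]; rewrite /prod_deg /= !kdeg_comp // add_row_mx.
- exact: prod_fact.
Defined.

Lemma prod_edge1_subproof (e : edge_of L) (w : kobj G) :
  [exists i : 'I_(k1 + k2), kdeg ((val e, kid w) : kmor kprod) == delta_mx 0 i].
Proof.
case: e => e /= /existsP[i /eqP he]; apply/existsP; exists (lshift k2 i).
by rewrite /= /prod_deg /= he kdeg_id; apply/eqP; rewrite -delta_mx_lshift.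
Qed.

Lemma prod_edge2_subproof (x : kobj L) (f : edge_of G) :
  [exists i : 'I_(k1 + k2), kdeg ((kid x, val f) : kmor kprod) == delta_mx 0 i].
Proof.
case: f => f /= /existsP[i /eqP hf]; apply/existsP; exists (rshift k1 i).
by rewrite /= /prod_deg /= hf kdeg_id; apply/eqP; rewrite -delta_mx_rshift.
Qed.

Definition prod_edge1 (e : edge_of L) (w : kobj G) : edge_of kprod :=
  exist _ (val e, kid w) (prod_edge1_subproof e w).

Definition prod_edge2 (x : kobj L) (f : edge_of G) : edge_of kprod :=
  exist _ (kid x, val f) (prod_edge2_subproof x f).

End Product.

(******************************************************************************)

(* A copy of the one-skeleton of a k-graph L in that of an l-graph O, made of *)
(* all the edges of O of certain colors around the vertices of L. Below, the  *)
(* instances are the copies G(L) x {w} and {x} x G(G) in a quasi-product.     *)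
Record slice k l (L : kgraph k) (O : kgraph l) := Slice {
  sl_v : kobj L -> kobj O;
  sl_e : edge_of L -> edge_of O;
  sl_in : 'rV[nat]_k -> 'rV[nat]_l;
  sl_pr : 'rV[nat]_l -> 'rV[nat]_k;
  sl_inD : {morph sl_in : m n / m + n};
  sl_inK : cancel sl_in sl_pr;
  sl_v_inj : injective sl_v;
  sl_e_inj : injective sl_e;
  sl_r : forall e, kr (val (sl_e e)) = sl_v (kr (val e));
  sl_s : forall e, ks (val (sl_e e)) = sl_v (ks (val e));
  sl_d : forall e, kdeg (val (sl_e e)) = sl_in (kdeg (val e));
  sl_full : forall mu i x, kdeg mu = sl_in (delta_mx 0 i) -> kr mu = sl_v x ->
    exists2 e, kr (val e) = x & val (sl_e e) = mu
}.

Section Slice.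
Variables (k l : nat) (L : kgraph k) (O : kgraph l) (S : slice L O).

(* The composite in O of the copy of the path p. *)
Fixpoint pcomp (x y : kobj L) (p : @gpath (skeleton L) x y) : kmor O :=
  match p with
  | gnil x => kid (sl_v S x)
  | gcons e _ q => kcomp (val (sl_e S e)) (pcomp q)
  end.

Definition in_fiber (mu : kmor O) : Prop :=
  exists (x y : kobj L) (p : @gpath (skeleton L) x y), pcomp p = mu.

Definition fiber : countType := {mu : kmor O | `[< in_fiber mu >]}.

Lemma fiberP (mu : fiber) : in_fiber (val mu).
Proof. by case: mu => mu /= /asboolP. Qed.

Definition to_fiber (mu : kmor O) (h : in_fiber mu) : fiber :=
  exist _ mu (asboolT h).

Lemma pcomp_in_fiber x y (p : @gpath (skeleton L) x y) : in_fiber (pcomp p).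
Proof. by exists x, y, p. Qed.

Definition pclass x y (p : @gpath (skeleton L) x y) : fiber :=
  to_fiber (pcomp_in_fiber p).

Lemma sl_in0 : sl_in S 0 = 0.
Proof.
have := sl_inD S 0 0; rewrite addr0 => /matrixP h; apply/matrixP => i j.
have := h i j; rewrite !mxE => /esym/eqP.
by rewrite -[X in _ == X]addr0 eqn_add2l => /eqP.
Qed.

Lemma pcomp_r x y (p : @gpath (skeleton L) x y) : kr (pcomp p) = sl_v S x
with pcomp_s x y (p : @gpath (skeleton L) x y) : ks (pcomp p) = sl_v S y.
Proof.
  by case: p => [v|e z q] /=; rewrite ?kr_id // kr_comp ?sl_r // sl_s pcomp_r.
by case: p => [v|e z q] /=; rewrite ?ks_id // ks_comp ?pcomp_s // sl_s pcomp_r.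
Qed.

Lemma pcomp_d x y (p : @gpath (skeleton L) x y) :
  kdeg (pcomp p) = sl_in S (\sum_(c <- color_order p) c).
Proof.
elim: p => [v|e z q IH] /=; first by rewrite big_nil kdeg_id sl_in0.
by rewrite kdeg_comp ?sl_s ?pcomp_r // big_cons sl_inD sl_d IH.
Qed.

Definition is_color (c : 'rV[nat]_k) : bool :=
  [exists i : 'I_k, c == delta_mx 0 i].

Lemma color_order_colors x y (p : @gpath (skeleton L) x y) :
  all is_color (color_order p).
Proof. by elim: p => [v|e z q IH] //=; rewrite IH andbT; case: e q IH. Qed.

Lemma color_decomp (m : 'rV[nat]_k) :
  exists2 c, all is_color c & \sum_(a <- c) a = m.
Proof.
exists (flatten [seq nseq (m 0 i) (delta_mx 0 i) | i <- enum 'I_k]).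
  apply/allP => a /flatten_mapP[i _] /nseqP[-> _].
  by apply/existsP; exists i.
rewrite big_flatten big_map big_enum /= [RHS]row_sum_delta.
apply: eq_bigr => i _; rewrite big_nseq.
elim: (m 0 i) => [|n IH] /=; first by rewrite scale0r.
by rewrite IH -{1}(scale1r (delta_mx _ _)) -scalerDl.
Qed.

Lemma pcomp_exists (c : seq 'rV[nat]_k) mu x : all is_color c ->
  kdeg mu = sl_in S (\sum_(a <- c) a) -> kr mu = sl_v S x ->
  exists y (p : @gpath (skeleton L) x y), color_order p = c /\ pcomp p = mu.
Proof.
elim: c mu x => [|a c IH] mu x /=.
  rewrite big_nil sl_in0 => _ /kdeg0 -> hx.
  by exists x, (gnil (G := skeleton L) x); rewrite /= -hx kr_id.
move=> /andP[/existsP[i /eqP ai] hc]; rewrite big_cons sl_inD => d hr.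
have [e1 e2 d1 d2] := kfactorP d.
have hr1 : kr (kfactor d).1 = sl_v S x by rewrite -hr [in RHS]e2 kr_comp.
have d1' : kdeg (kfactor d).1 = sl_in S (delta_mx 0 i) by rewrite d1 ai.
have [e ex ee] := sl_full d1' hr1.
have hr2 : kr (kfactor d).2 = sl_v S (ks (val e)) by rewrite -sl_s ee e1.
have [y [q [cq pq]]] := IH _ _ hc d2 hr2.
case: x / ex hr hr1 => hr hr1.
exists y, (gcons (G := skeleton L) e q); split=> /=; last by rewrite pq ee -e2.
rewrite cq; congr cons; apply: (can_inj (sl_inK S)).
by rewrite -sl_d ee d1.
Qed.

Lemma pcomp_inj_sig x y (p : @gpath (skeleton L) x y)
    x' y' (p' : @gpath (skeleton L) x' y') :
  color_order p = color_order p' -> pcomp p = pcomp p' ->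
  existT (fun xy : kobj L * kobj L => @gpath (skeleton L) xy.1 xy.2) (x, y) p =
  existT (fun xy : kobj L * kobj L => @gpath (skeleton L) xy.1 xy.2) (x', y') p'.
Proof.
elim: p x' y' p' => [v|e z q IH] x' y' [v'|e' z' q'] //=.
  by move=> _ /(congr1 (@kr _ O)); rewrite !kr_id => /sl_v_inj ->.
case=> ce cq eq.
have [] := kcompI _ _ _ _ eq; rewrite ?sl_s ?pcomp_r //.
- by rewrite !sl_d; congr sl_in.
- by rewrite !pcomp_d cq.
move=> /val_inj/sl_e_inj ee {eq}; subst e' => pq.
have h := IH _ _ _ cq pq.
have := congr1 (fun t => (projT1 t).2) h => /= hz; subst z'.
suff -> : q = q' by [].
by apply: (Eqdep_dec.inj_pair2_eq_dec _ _ _ _ _ _ h) => a b; exact: eq_comparable.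
Qed.

Lemma pcomp_inj x y (p p' : @gpath (skeleton L) x y) :
  color_order p = color_order p' -> pcomp p = pcomp p' -> p = p'.
Proof.
move=> hc hp; have := pcomp_inj_sig hc hp.
by apply: Eqdep_dec.inj_pair2_eq_dec => a b; exact: eq_comparable.
Qed.

(* The k-graph structure on the fiber, an object x standing for the vertex    *)
(* sl_v x of O.                                                               *)

Lemma in_fiber_r (mu : fiber) : exists x, kr (val mu) = sl_v S x.
Proof.
by have [x [y [p <-]]] := fiberP mu; exists x; rewrite pcomp_r.
Qed.

Lemma in_fiber_s (mu : fiber) : exists x, ks (val mu) = sl_v S x.
Proof.
by have [x [y [p <-]]] := fiberP mu; exists y; rewrite pcomp_s.
Qed.

Definition fiber_r (mu : fiber) : kobj L := sval (cid (in_fiber_r mu)).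
Definition fiber_s (mu : fiber) : kobj L := sval (cid (in_fiber_s mu)).
Definition fiber_id (x : kobj L) : fiber := pclass (gnil (G := skeleton L) x).
(* If mu and nu are composable, then so is their composite in the fiber, and  *)
(* the default value mu of insubd is not used (see fiber_compE).              *)
Definition fiber_comp (mu nu : fiber) : fiber :=
  insubd mu (kcomp (val mu) (val nu)).
Definition fiber_deg (mu : fiber) : 'rV[nat]_k := sl_pr S (kdeg (val mu)).

Lemma fiber_rE mu : kr (val mu) = sl_v S (fiber_r mu).
Proof. by rewrite /fiber_r; case: cid. Qed.

Lemma fiber_sE mu : ks (val mu) = sl_v S (fiber_s mu).
Proof. by rewrite /fiber_s; case: cid. Qed.

Lemma fiber_degE mu : kdeg (val mu) = sl_in S (fiber_deg mu).
Proof.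
rewrite /fiber_deg; have [x [y [p <-]]] := fiberP mu.
by rewrite pcomp_d sl_inK.
Qed.

Lemma in_fiberP (mu : kmor O) :
  in_fiber mu <->
  (exists m, kdeg mu = sl_in S m) /\ (exists x, kr mu = sl_v S x).
Proof.
split=> [[x [y [p <-]]]|[[m hm] [x hx]]].
  by split; [rewrite pcomp_d; eexists | rewrite pcomp_r; eexists].
have [c hc cm] := color_decomp m; rewrite -cm in hm.
by have [y [p [_ hp]]] := pcomp_exists hc hm hx; exists x, y, p.
Qed.

Lemma fiber_compE (mu nu : fiber) : fiber_s mu = fiber_r nu ->
  val (fiber_comp mu nu) = kcomp (val mu) (val nu).
Proof.
move=> h; rewrite /fiber_comp insubdK //.
have c : ks (val mu) = kr (val nu) by rewrite fiber_sE fiber_rE h.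
apply/asboolP/in_fiberP; split.
  by rewrite kdeg_comp // !fiber_degE -sl_inD; eexists.
by rewrite kr_comp // fiber_rE; eexists.
Qed.

Lemma fiber_composable (mu nu : fiber) :
  fiber_s mu = fiber_r nu <-> ks (val mu) = kr (val nu).
Proof. by rewrite fiber_sE fiber_rE; split=> [->|/sl_v_inj]. Qed.

Lemma fiber_fact la m n : fiber_deg la = m + n ->
  exists! munu : fiber * fiber,
    [/\ fiber_s munu.1 = fiber_r munu.2, la = fiber_comp munu.1 munu.2,
        fiber_deg munu.1 = m & fiber_deg munu.2 = n].
Proof.
move=> h; have d : kdeg (val la) = sl_in S m + sl_in S n.
  by rewrite -sl_inD -h fiber_degE.
have [c e d1 d2] := kfactorP d.
have f1 : in_fiber (kfactor d).1.
  apply/in_fiberP; split; first by exists m.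
  by exists (fiber_r la); rewrite -fiber_rE [in RHS]e kr_comp.
pose mu := to_fiber f1.
have f2 : in_fiber (kfactor d).2.
  apply/in_fiberP; split; first by exists n.
  by exists (fiber_s mu); rewrite -fiber_sE -c.
pose nu := to_fiber f2.
have cmn : fiber_s mu = fiber_r nu by apply/fiber_composable.
exists (mu, nu); split=> /=.
  split=> //.
  - by apply: val_inj; rewrite fiber_compE //= -e.
  - by rewrite /fiber_deg /= d1 sl_inK.
  - by rewrite /fiber_deg /= d2 sl_inK.
case=> mu' nu' /= [c' e' d1' d2'].
have [] := @kcompI _ _ (val mu) (val nu) (val mu') (val nu').
- exact/fiber_composable.
- exact/fiber_composable.
- by rewrite /= d1 fiber_degE d1'.
- by rewrite /= d2 fiber_degE d2'.
- by rewrite -(fiber_compE c') -e' /= -e.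
by move=> /val_inj <- /val_inj <-.
Qed.

Definition fiber_kgraph : kgraph k.
Proof.
apply: (@KGraph _ (kobj L) fiber fiber_r fiber_s fiber_id fiber_comp fiber_deg).
- by move=> v; apply: (@sl_v_inj _ _ _ _ S); rewrite -fiber_rE /= kr_id.
- by move=> v; apply: (@sl_v_inj _ _ _ _ S); rewrite -fiber_sE /= ks_id.
- move=> mu nu h; apply: (@sl_v_inj _ _ _ _ S).
  by rewrite -!fiber_rE fiber_compE // kr_comp //; apply/fiber_composable.
- move=> mu nu h; apply: (@sl_v_inj _ _ _ _ S).
  by rewrite -!fiber_sE fiber_compE // ks_comp //; apply/fiber_composable.
- move=> mu; apply: val_inj; rewrite fiber_compE /= -?fiber_rE ?kcomp1m //.
  by apply/fiber_composable; rewrite /= ks_id fiber_rE.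
- move=> mu; apply: val_inj; rewrite fiber_compE /= -?fiber_sE ?kcompm1 //.
  by apply/fiber_composable; rewrite /= kr_id fiber_sE.
- move=> la mu nu /[dup] h1 /fiber_composable h1' /[dup] h2 /fiber_composable h2'.
  have c1 : fiber_s la = fiber_r (fiber_comp mu nu).
    by apply/fiber_composable; rewrite fiber_compE // kr_comp.
  have c2 : fiber_s (fiber_comp la mu) = fiber_r nu.
    by apply/fiber_composable; rewrite fiber_compE // ks_comp.
  by apply: val_inj; rewrite !fiber_compE // kcompA.
- move=> v; apply: (can_inj (sl_inK S)).
  by rewrite -fiber_degE sl_in0 /= kdeg_id.
- move=> mu nu h; apply: (can_inj (sl_inK S)).
  rewrite sl_inD -!fiber_degE fiber_compE // kdeg_comp //.
  exact/fiber_composable.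
- exact: fiber_fact.
Defined.

End Slice.

(******************************************************************************)

Section Labelled.
Variables (k1 k2 : nat) (L : kgraph k1) (G : kgraph k2) (O : kgraph (k1 + k2)).
Variable phi : cgraph_iso (skeleton (kprod L G)) (skeleton O).

Section Slice1.
Variable w : kobj G.

Definition slice1_v (x : kobj L) : kobj O := iso_v phi (x, w).
Definition slice1_e (e : edge_of L) : edge_of O := iso_e phi (prod_edge1 e w).

Lemma slice1_v_inj : injective slice1_v.
Proof. by move=> x y /(bij_inj (iso_v_bij phi))[]. Qed.

Lemma slice1_e_inj : injective slice1_e.
Proof. by move=> e f /(bij_inj (iso_e_bij phi))[/val_inj]. Qed.

Lemma slice1_r e : kr (val (slice1_e e)) = slice1_v (kr (val e)).
Proof. by have := iso_r phi (prod_edge1 e w); rewrite /= /prod_r /= kr_id. Qed.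

Lemma slice1_s e : ks (val (slice1_e e)) = slice1_v (ks (val e)).
Proof. by have := iso_s phi (prod_edge1 e w); rewrite /= /prod_s /= ks_id. Qed.

Lemma slice1_d e : kdeg (val (slice1_e e)) = row_mx (kdeg (val e)) 0.
Proof.
by have := iso_col phi (prod_edge1 e w); rewrite /= /prod_deg /= kdeg_id.
Qed.

Lemma slice1_D : {morph (fun m : 'rV[nat]_k1 => row_mx m (0 : 'rV_k2)) :
  m n / m + n}.
Proof. by move=> m n /=; rewrite add_row_mx addr0. Qed.

Lemma slice1_full mu i x :
  kdeg mu = row_mx (delta_mx 0 i) 0 -> kr mu = slice1_v x ->
  exists2 e, kr (val e) = x & val (slice1_e e) = mu.
Proof.
move=> d hr; have Emu : [exists j, kdeg mu == delta_mx 0 j].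
  by apply/existsP; exists (lshift k2 i); rewrite d -delta_mx_lshift.
have [psi phiK psiK] := iso_e_bij phi.
pose m : edge_of O := exist _ mu Emu.
have := iso_r phi (psi m); have := iso_col phi (psi m); rewrite psiK /= d hr.
move: (psiK m); case: (psi m) => -[a b] /= Eab em.
rewrite /prod_deg => /eq_row_mx[da db] /(bij_inj (iso_v_bij phi))[ha hb].
have Ea : [exists j, kdeg a == delta_mx 0 j].
  by apply/existsP; exists i; rewrite -da.
have {}db : b = kid w by rewrite hb; apply/kdeg0.
exists (exist _ a Ea) => //=.
rewrite /slice1_e -[mu]/(val m) -em; congr (val (iso_e phi _)).
by apply: val_inj; rewrite /= -db.
Qed.

Definition slice1 : slice L O :=
  Slice slice1_D (fun m => row_mxKl m 0) slice1_v_inj slice1_e_inj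
    slice1_r slice1_s slice1_d slice1_full.

End Slice1.

Section Slice2.
Variable x : kobj L.

Definition slice2_v (w : kobj G) : kobj O := iso_v phi (x, w).
Definition slice2_e (f : edge_of G) : edge_of O := iso_e phi (prod_edge2 x f).

Lemma slice2_v_inj : injective slice2_v.
Proof. by move=> v w /(bij_inj (iso_v_bij phi))[]. Qed.

Lemma slice2_e_inj : injective slice2_e.
Proof. by move=> e f /(bij_inj (iso_e_bij phi))[/val_inj]. Qed.

Lemma slice2_r f : kr (val (slice2_e f)) = slice2_v (kr (val f)).
Proof. by have := iso_r phi (prod_edge2 x f); rewrite /= /prod_r /= kr_id. Qed.

Lemma slice2_s f : ks (val (slice2_e f)) = slice2_v (ks (val f)).
Proof. by have := iso_s phi (prod_edge2 x f); rewrite /= /prod_s /= ks_id. Qed.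

Lemma slice2_d f : kdeg (val (slice2_e f)) = row_mx 0 (kdeg (val f)).
Proof.
by have := iso_col phi (prod_edge2 x f); rewrite /= /prod_deg /= kdeg_id.
Qed.

Lemma slice2_D : {morph (fun n : 'rV[nat]_k2 => row_mx (0 : 'rV_k1) n) :
  m n / m + n}.
Proof. by move=> m n /=; rewrite add_row_mx addr0. Qed.

Lemma slice2_full mu i w :
  kdeg mu = row_mx 0 (delta_mx 0 i) -> kr mu = slice2_v w ->
  exists2 f, kr (val f) = w & val (slice2_e f) = mu.
Proof.
move=> d hr; have Emu : [exists j, kdeg mu == delta_mx 0 j].
  by apply/existsP; exists (rshift k1 i); rewrite d -delta_mx_rshift.
have [psi phiK psiK] := iso_e_bij phi.
pose m : edge_of O := exist _ mu Emu.
have := iso_r phi (psi m); have := iso_col phi (psi m); rewrite psiK /= d hr.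
move: (psiK m); case: (psi m) => -[a b] /= Eab em.
rewrite /prod_deg => /eq_row_mx[da db] /(bij_inj (iso_v_bij phi))[ha hb].
have Eb : [exists j, kdeg b == delta_mx 0 j].
  by apply/existsP; exists i; rewrite -db.
have {}da : a = kid x by rewrite ha; apply/kdeg0.
exists (exist _ b Eb) => //=.
rewrite /slice2_e -[mu]/(val m) -em; congr (val (iso_e phi _)).
by apply: val_inj; rewrite /= -da.
Qed.

Definition slice2 : slice G O :=
  Slice slice2_D (fun n => row_mxKr 0 n) slice2_v_inj slice2_e_inj
    slice2_r slice2_s slice2_d slice2_full.

End Slice2.

(* Omega_1^w x {w} and {x} x Omega_2^x, with ([p], w) = [p]_w and             *)
(* (x, [q]) = [q]_x.                                                          *)
Definition fiber1 (w : kobj G) : countType := fiber (slice1 w).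
Definition fiber2 (x : kobj L) : countType := fiber (slice2 x).

Definition class1 (w : kobj G) x y (p : @gpath (skeleton L) x y) : fiber1 w :=
  pclass (slice1 w) p.
Definition class2 (x : kobj L) w v (q : @gpath (skeleton G) w v) : fiber2 x :=
  pclass (slice2 x) q.

Definition fiber1_kgraph (w : kobj G) : kgraph k1 := fiber_kgraph (slice1 w).
Definition fiber2_kgraph (x : kobj L) : kgraph k2 := fiber_kgraph (slice2 x).

Section Actions.
Variables (x y : kobj L) (w v : kobj G).
Variables (p : @gpath (skeleton L) x y) (q : @gpath (skeleton G) w v).

Lemma swap_composable : ks (val (class1 w p)) = kr (val (class2 y q)).
Proof. by rewrite /= pcomp_s pcomp_r. Qed.

Lemma swap_subproof :
  kdeg (kcomp (val (class1 w p)) (val (class2 y q))) =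
  kdeg (val (class2 y q)) + kdeg (val (class1 w p)).
Proof. by rewrite kdeg_comp ?swap_composable // addrC. Qed.

(* The pair (beta, alpha). *)
Definition swap : kmor O * kmor O := kfactor swap_subproof.

Lemma act_subproof :
  (exists q' : @gpath (skeleton G) w v,
    color_order q' = color_order q /\ val (class2 x q') = swap.1) /\
  (exists p' : @gpath (skeleton L) x y,
    color_order p' = color_order p /\ val (class1 v p') = swap.2).
Proof.
have [c e d1 d2] := kfactorP swap_subproof; rewrite -/swap in c e d1 d2.
have r1 : kr swap.1 = sl_v (slice2 x) w.
  have := kr_comp c; rewrite -e kr_comp ?swap_composable //= pcomp_r => <- //.
have d1' : kdeg swap.1 = sl_in (slice2 x) (\sum_(a <- color_order q) a).
  by rewrite d1 /= pcomp_d.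
have [v' [q' [cq' hq']]] := pcomp_exists (color_order_colors q) d1' r1.
have r2 : kr swap.2 = sl_v (slice1 v') x by rewrite -c -hq' pcomp_s.
have d2' : kdeg swap.2 = sl_in (slice1 v') (\sum_(a <- color_order p) a).
  by rewrite d2 /= pcomp_d.
have [y' [p' [cp' hp']]] := pcomp_exists (color_order_colors p) d2' r2.
have := ks_comp c; rewrite -e ks_comp ?swap_composable //= -hp' !pcomp_s /=.
move=> /(bij_inj (iso_v_bij phi))[ey ev]; subst y' v'.
by split; [exists q' | exists p'].
Qed.

(* actR is p_|>(q) and actL is q_<|(p); see act_comp and act_uniq. *)
Definition actR : @gpath (skeleton G) w v := sval (cid act_subproof.1).
Definition actL : @gpath (skeleton L) x y := sval (cid act_subproof.2).

Lemma actRP : color_order actR = color_order q /\ val (class2 x actR) = swap.1.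
Proof. by rewrite /actR; case: cid. Qed.

Lemma actLP : color_order actL = color_order p /\ val (class1 v actL) = swap.2.
Proof. by rewrite /actL; case: cid. Qed.

Lemma act_comp :
  kcomp (val (class1 w p)) (val (class2 y q)) =
  kcomp (val (class2 x actR)) (val (class1 v actL)).
Proof. by rewrite actRP.2 actLP.2; case: (kfactorP swap_subproof). Qed.

Lemma act_uniq (q' : @gpath (skeleton G) w v) (p' : @gpath (skeleton L) x y) :
  color_order q' = color_order q -> color_order p' = color_order p ->
  kcomp (val (class1 w p)) (val (class2 y q)) =
    kcomp (val (class2 x q')) (val (class1 v p')) ->
  q' = actR /\ p' = actL.
Proof.
move=> cq cp; rewrite act_comp => h.
have [] := kcompI _ _ _ _ h; rewrite /= ?pcomp_r ?pcomp_s //.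
- by rewrite !pcomp_d cq actRP.1.
- by rewrite !pcomp_d cp actLP.1.
move=> h1 h2; split; apply/esym; first exact: pcomp_inj (etrans actRP.1 _) h1.
exact: pcomp_inj (etrans actLP.1 _) h2.
Qed.

End Actions.

(* The maps induced on classes; they are computed from an arbitrary           *)
(* representative of the argument, on which they do not depend (hatRE and     *)
(* hatLE).                                                                    *)
Definition hatR (x y : kobj L) (p : @gpath (skeleton L) x y) (b : fiber2 y) :
    fiber2 x :=
  let: exist w rep := cid (fiberP b) in
  let: exist v rep := cid rep in
  let: exist q _ := cid rep in
  class2 x (actR p q).

Definition hatL (w v : kobj G) (q : @gpath (skeleton G) w v) (a : fiber1 w) :
    fiber1 v :=
  let: exist x rep := cid (fiberP a) in
  let: exist y rep := cid rep in
  let: exist p _ := cid rep in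
  class1 v (actL p q).

Lemma hatRE x y (p : @gpath (skeleton L) x y) w v (q : @gpath (skeleton G) w v) :
  hatR p (class2 y q) = class2 x (actR p q).
Proof.
rewrite /hatR; case: cid => w' rep1; case: cid => v' rep2.
case: cid => q'' eq {rep1 rep2}.
have ew : w' = w.
  have := congr1 (@kr _ O) eq; rewrite /= !pcomp_r.
  exact: (@slice2_v_inj y).
have ev : v' = v.
  have := congr1 (@ks _ O) eq; rewrite /= !pcomp_s.
  exact: (@slice2_v_inj y).
subst w' v'; apply: val_inj; rewrite (actRP p q'').2 (actRP p q).2.
have eqv : val (class2 y q'') = val (class2 y q) by [].
have [c1 e1 f1 g1] := kfactorP (swap_subproof p q'').
have [c2 e2 f2 g2] := kfactorP (swap_subproof p q).
rewrite -!/(swap _ _) in c1 e1 f1 g1 c2 e2 f2 g2.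
by have [] := kcompI c1 c2; rewrite -?e1 -?e2 ?f1 ?f2 ?g1 ?g2 ?eqv.
Qed.

Lemma hatLE w v (q : @gpath (skeleton G) w v) x y (p : @gpath (skeleton L) x y) :
  hatL q (class1 w p) = class1 v (actL p q).
Proof.
rewrite /hatL; case: cid => x' rep1; case: cid => y' rep2.
case: cid => p'' eq {rep1 rep2}.
have ex : x' = x.
  have := congr1 (@kr _ O) eq; rewrite /= !pcomp_r.
  exact: (@slice1_v_inj w).
have ey : y' = y.
  have := congr1 (@ks _ O) eq; rewrite /= !pcomp_s.
  exact: (@slice1_v_inj w).
subst x' y'; apply: val_inj; rewrite (actLP p'' q).2 (actLP p q).2.
have eqv : val (class1 w p'') = val (class1 w p) by [].
have [c1 e1 f1 g1] := kfactorP (swap_subproof p'' q).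
have [c2 e2 f2 g2] := kfactorP (swap_subproof p q).
rewrite -!/(swap _ _) in c1 e1 f1 g1 c2 e2 f2 g2.
by have [] := kcompI c1 c2; rewrite -?e1 -?e2 ?f1 ?f2 ?g1 ?g2 ?eqv.
Qed.

Lemma bij_inv_subproof (A B : Type) (f : A -> B) :
  bijective f -> exists g, cancel f g /\ cancel g f.
Proof. by case=> g fK gK; exists g. Qed.

Definition bij_inv (A B : Type) (f : A -> B) (h : bijective f) : B -> A :=
  sval (cid (bij_inv_subproof h)).

Section WalkR.
Hypothesis bij : forall e : gedge (skeleton L), bijective (hatR (gpath1 e)).

Definition walkR1 (eb : gedge (double (skeleton L))) :
    fiber2 (gsrc eb) -> fiber2 (grng eb) :=
  match eb with
  | (e, true) => hatR (gpath1 e)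
  | (e, false) => bij_inv (bij e)
  end.

Fixpoint walkR x y (xi : @gpath (double (skeleton L)) x y) :
    fiber2 y -> fiber2 x :=
  match xi with
  | gnil _ => id
  | gcons eb _ xi' => fun b => walkR1 (walkR xi' b)
  end.

End WalkR.

Section WalkL.
Hypothesis bij : forall f : gedge (skeleton G), bijective (hatL (gpath1 f)).

Definition walkL1 (fb : gedge (double (skeleton G))) :
    fiber1 (grng fb) -> fiber1 (gsrc fb) :=
  match fb with
  | (f, true) => hatL (gpath1 f)
  | (f, false) => bij_inv (bij f)
  end.

Fixpoint walkL w v (ze : @gpath (double (skeleton G)) w v) :
    fiber1 w -> fiber1 v :=
  match ze with
  | gnil _ => id
  | gcons fb _ ze' => fun a => walkL ze' (walkL1 a)
  end.

End WalkL.

(* G, resp. L, is a relaxed stable quasi-factor. *)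
Definition relaxed_stable2 : Prop :=
  exists bij : forall x y (p : @gpath (skeleton L) x y), bijective (hatR p),
  forall x y (xi xi' : @gpath (double (skeleton L)) x y),
    walkR (fun e => bij _ _ (gpath1 e)) xi
      =1 walkR (fun e => bij _ _ (gpath1 e)) xi'.

Definition relaxed_stable1 : Prop :=
  exists bij : forall w v (q : @gpath (skeleton G) w v), bijective (hatL q),
  forall w v (ze ze' : @gpath (double (skeleton G)) w v),
    walkL (fun f => bij _ _ (gpath1 f)) ze
      =1 walkL (fun f => bij _ _ (gpath1 f)) ze'.

End Labelled.

(* The existence of the functors qp_psi1 and qp_psi2 alone does not imply that *)
(* L and G are isomorphic to fibers of O; this is the role of the last two     *)
(* fields.                                                                     *)
Record quasi_product k1 k2 (L : kgraph k1) (G : kgraph k2)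
    (O : kgraph (k1 + k2)) := QuasiProduct {
  qp_iso : cgraph_iso (skeleton (kprod L G)) (skeleton O);
  qp_psi1 : kfunctor L O;
  qp_psi2 : kfunctor G O;
  qp_psi1_inj : injective (fmor qp_psi1);
  qp_psi2_inj : injective (fmor qp_psi2);
  qp_psi1_deg : forall la, kdeg la = lsubmx (kdeg (fmor qp_psi1 la));
  qp_psi2_deg : forall ga, kdeg ga = rsubmx (kdeg (fmor qp_psi2 ga));
  qp_fiber1 : exists w0, kiso (fiber1_kgraph qp_iso w0) L;
  qp_fiber2 : exists x0, kiso (fiber2_kgraph qp_iso x0) G
}.

(* Main.v *)
(* Every element of Omega is alpha beta with alpha in Omega_1 and beta in     *)
(* Omega_2, and the maps p_|> and q_<| interchange such factors, i.e. close   *)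
(* them up to a commuting square alpha beta = beta' alpha'.                   *)
(*                                                                            *)
(* An isomorphism Omega -> Lambda x Gamma gives alpha and alpha' the same     *)
(* first component, because those of beta and beta' are identities. By        *)
(* connectedness, the first component is a bijection Omega_1^w -> Lambda for  *)
(* each w; as the hats preserve it, they are bijective and path-independent.  *)
(*                                                                            *)
(* Conversely, under relaxed stability a hat depends only on the endpoints of *)
(* the path. Pasting two squares then shows that it is multiplicative, so     *)
(* that walks to a base vertex give isomorphisms of k-graphs                  *)
(* Omega_1^w ~ Omega_1^w0 and Omega_2^x ~ Omega_2^x0. Applied to alpha and    *)
(* beta, these are invariant under the interchange of factors, hence give an  *)
(* isomorphism Omega ~ Omega_1^w0 x Omega_2^x0 ~ Lambda x Gamma.              *)
From mathcomp Require all_boot all_algebra boolp.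
Require Import Defs.

Module QuasiProductTheory.

Import all_boot all_algebra boolp Defs.
Set Implicit Arguments.
Unset Strict Implicit.
Unset Printing Implicit Defensive.

Import GRing.Theory.
Local Open Scope ring_scope.

(** Both directions rest on commuting squares al be = be' al' in Omega with al, al' in Omega_1 and
    be, be' in Omega_2 ([square]): by unique factorization al and be determine the square, squares
    can be pasted, and the hats read off their sides.

    Under relaxed stability, parallel paths have the same hat, so pasting makes the hats functors
    ([hatL_morphic], [hatR_morphic]). Walks to a base vertex then identify all fibers with one
    fiber, compatibly with the hats ([relaxed_stable1_transport], [relaxed_stable2_transport]).
    Factoring an arrow as al be and transporting both factors gives an isomorphism onto the product
    of two base fibers ([coordinates_kiso]), which can be chosen isomorphic to Lambda and Gamma.

    Conversely, an isomorphism F from Omega to Lambda x Gamma need not respect the labelling of the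
    skeleton. Connectedness still makes its second component constant on Lambda x {w}, so its first
    component is a bijection from each Omega_1^w to Lambda ([fiber1_fst_bij]). The hats preserve
    this component ([fiber1_fst_hat]), which forces them to be bijective and independent of the
    path; [fiber2_snd] plays the same role for Omega_2^x. *)

Lemma inj_surj_bij (A B : Type) (f : A -> B) :
  injective f -> (forall b, exists a, f a = b) -> bijective f.
Proof.
move=> fI fS; exists (fun b => sval (cid (fS b))) => [a|b].
  by apply: fI; case: cid.
by case: cid.
Qed.

Lemma bij_surj (A B : Type) (f : A -> B) :
  bijective f -> forall b, exists a, f a = b.
Proof. by case=> g _ gK b; exists (g b). Qed.

Lemma bij_factor (A B C : Type) (f : A -> B) (g : B -> C) (g' : A -> C) :
  bijective g -> bijective g' -> (forall a, g (f a) = g' a) -> bijective f.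
Proof.
move=> gb g'b e; apply: inj_surj_bij => [a a' h|b].
  by apply: (bij_inj g'b); rewrite -!e h.
have [a ea] := bij_surj g'b (g b).
by exists a; apply: (bij_inj gb); rewrite e.
Qed.

Lemma bij_prod (A A' B B' : Type) (f : A -> A') (g : B -> B') :
  bijective f -> bijective g -> bijective (fun x => (f x.1, g x.2)).
Proof.
by case=> f' fK f'K [g' gK g'K]; exists (fun x => (f' x.1, g' x.2));
  case=> x y /=; rewrite ?fK ?gK ?f'K ?g'K.
Qed.

Lemma bij_invK (A B : Type) (f : A -> B) (h : bijective f) :
  cancel (bij_inv h) f.
Proof. by rewrite /bij_inv; case: cid => g []. Qed.

Lemma bij_inv_bij (A B : Type) (f : A -> B) (h : bijective f) :
  bijective (bij_inv h).
Proof. by rewrite /bij_inv; case: cid => g [/=]; exists f. Qed.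

Lemma connected_const (D : digraph) (A : Type) (h : gvert D -> A) :
  connected D -> (forall e : gedge D, h (grng e) = h (gsrc e)) ->
  forall x y, h x = h y.
Proof.
move=> cD he x y; have [p] := cD x y.
by elim: p => [//|[e []] z p <-] /=; rewrite he.
Qed.

(** * Degree-preserving functors and isomorphisms *)

Definition kmorphic k (A B : kgraph k) (o : kobj A -> kobj B)
    (h : kmor A -> kmor B) : Prop :=
  [/\ forall a, kr (h a) = o (kr a), forall a, ks (h a) = o (ks a),
      forall a, kdeg (h a) = kdeg a &
      forall a a', ks a = kr a' -> h (kcomp a a') = kcomp (h a) (h a')].

Section Kmorphic.
Variable k : nat.
Implicit Types A B C : kgraph k.

Lemma kmorphic_id A : kmorphic (@id (kobj A)) id.
Proof. by []. Qed.

Lemma kmorphic_comp A B C (o : kobj A -> kobj B) (o' : kobj B -> kobj C) h h' :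
  kmorphic o h -> kmorphic o' h' -> kmorphic (o' \o o) (h' \o h).
Proof.
case=> hr hs hd hc [hr' hs' hd' hc']; split=> [a|a|a|a a' c] /=.
- by rewrite hr' hr.
- by rewrite hs' hs.
- by rewrite hd' hd.
- by rewrite hc // hc' // hr hs c.
Qed.

Lemma kmorphic_inv A B (o : kobj A -> kobj B) (o' : kobj B -> kobj A) h h' :
  kmorphic o h -> cancel o o' -> injective h -> cancel h' h -> kmorphic o' h'.
Proof.
case=> hr hs hd hc oK hI h'K; split=> [a|a|a|a a' c].
- by rewrite -[in RHS](h'K a) hr oK.
- by rewrite -[in RHS](h'K a) hs oK.
- by rewrite -[in RHS](h'K a) hd.
- apply: hI; rewrite hc ?h'K //; apply: (can_inj oK).
  by rewrite -hr -hs !h'K.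
Qed.

Lemma kmorphic_kiso A B (o : kobj A -> kobj B) h :
  kmorphic o h -> bijective o -> bijective h -> kiso A B.
Proof.
case=> hr hs hd hc ob hb.
(* Identities need not be required in [kmorphic]: an arrow of degree 0 is the identity of its
   range. *)
have hid v : h (kid v) = kid (o v).
  by rewrite ((kdeg0 (h (kid v))).1 _) ?hr ?kr_id // hd kdeg_id.
by exists (KFunctor hr hs hid hc).
Qed.

Lemma kiso_kmorphic A B : kiso A B ->
  exists o h, [/\ @kmorphic _ A B o h, bijective o & bijective h].
Proof.
case=> F [ob hb hd]; exists (fobj F), (fmor F); split=> //.
by split; [exact: fmor_r|exact: fmor_s|exact: hd|exact: fmor_comp].
Qed.

Lemma kiso_trans A B C : kiso A B -> kiso B C -> kiso A C.
Proof.
move=> /kiso_kmorphic[o [h [m ob hb]]] /kiso_kmorphic[o' [h' [m' ob' hb']]].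
by apply: kmorphic_kiso (kmorphic_comp m m') _ _; exact: bij_comp.
Qed.

End Kmorphic.

(** * Commuting squares and their pasting *)

(* By unique factorization, al and be determine be' and al'.                  *)
Definition square l (O : kgraph l) (al be be' al' : kmor O) : Prop :=
  [/\ ks al = kr be, ks be' = kr al', kcomp al be = kcomp be' al',
      kdeg al' = kdeg al & kdeg be' = kdeg be].

Section Square.
Variables (l : nat) (O : kgraph l).
Implicit Types al be : kmor O.

Lemma square_uniq al be be1 al1 be2 al2 :
  square al be be1 al1 -> square al be be2 al2 -> be1 = be2 /\ al1 = al2.
Proof.
case=> _ c1 e1 d1 f1 [_ c2 e2 d2 f2].
by apply: kcompI => //; congruence.
Qed.

Lemma square_sym al be be' al' : square al be be' al' -> square be' al' al be.
Proof. by case. Qed.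

Lemma square_r al be be' al' : square al be be' al' -> kr be' = kr al.
Proof. by case=> c c' e _ _; rewrite -(kr_comp c) e kr_comp. Qed.

Lemma square_s al be be' al' : square al be be' al' -> ks al' = ks be.
Proof. by case=> c c' e _ _; rewrite -(ks_comp c) e ks_comp. Qed.

Lemma square_id_r al : square al (kid (ks al)) (kid (kr al)) al.
Proof. by split; rewrite ?kr_id ?ks_id ?kcomp1m ?kcompm1 ?kdeg_id. Qed.

Lemma square_id_l be : square (kid (kr be)) be be (kid (ks be)).
Proof. by split; rewrite ?kr_id ?ks_id ?kcomp1m ?kcompm1 ?kdeg_id. Qed.

Lemma square_comp_l a a' be be1 be2 a1 a2 : ks a = kr a' ->
  square a' be be1 a1 -> square a be1 be2 a2 ->
  square (kcomp a a') be be2 (kcomp a2 a1).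
Proof.
move=> c s1 s2; have r1 := square_r s1; have t2 := square_s s2.
case: s1 s2 => [c1 c1' e1 d1 f1] [c2 c2' e2 d2 f2].
split; rewrite ?ks_comp ?kr_comp ?kdeg_comp ?d1 ?d2 ?f2 ?f1 //; try congruence.
have -> : kcomp (kcomp a a') be = kcomp (kcomp a be1) a1.
  by rewrite -kcompA // e1 kcompA //; congruence.
by rewrite e2 -kcompA //; congruence.
Qed.

Lemma square_comp_r al b b' be1 be2 al1 al2 : ks b = kr b' ->
  square al b be1 al1 -> square al1 b' be2 al2 ->
  square al (kcomp b b') (kcomp be1 be2) al2.
Proof.
move=> c s1 s2; have r2 := square_r s2; have t1 := square_s s1.
case: s1 s2 => [c1 c1' e1 d1 f1] [c2 c2' e2 d2 f2].
split; rewrite ?ks_comp ?kr_comp ?kdeg_comp ?d1 ?d2 ?f2 ?f1 //; try congruence.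
have -> : kcomp al (kcomp b b') = kcomp be1 (kcomp al1 b').
  by rewrite kcompA // e1 -kcompA //; congruence.
by rewrite e2 kcompA //; congruence.
Qed.

Lemma square_exists al be : ks al = kr be ->
  exists be' al', square al be be' al'.
Proof.
move=> c; have d : kdeg (kcomp al be) = kdeg be + kdeg al.
  by rewrite kdeg_comp // addrC.
by have [c' e d1 d2] := kfactorP d; exists (kfactor d).1, (kfactor d).2.
Qed.

End Square.

(** * The hats as maps between fibers *)

Lemma fiber_elim k l (L : kgraph k) (O : kgraph l) (S : slice L O)
    (P : fiber S -> Prop) :
  (forall x y (p : @gpath (skeleton L) x y), P (pclass S p)) -> forall a, P a.
Proof.
move=> h a; have [x [y [p ep]]] := fiberP a.
by have -> : a = pclass S p by exact: val_inj.
Qed.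

Lemma pclass_r k l (L : kgraph k) (O : kgraph l) (S : slice L O) x y
    (p : @gpath (skeleton L) x y) : fiber_r (pclass S p) = x.
Proof. by apply: (@sl_v_inj _ _ _ _ S); rewrite -fiber_rE pcomp_r. Qed.

Lemma pclass_s k l (L : kgraph k) (O : kgraph l) (S : slice L O) x y
    (p : @gpath (skeleton L) x y) : fiber_s (pclass S p) = y.
Proof. by apply: (@sl_v_inj _ _ _ _ S); rewrite -fiber_sE pcomp_s. Qed.

Section Hats.
Variables (k1 k2 : nat) (L : kgraph k1) (G : kgraph k2) (O : kgraph (k1 + k2)).
Variable phi : cgraph_iso (skeleton (kprod L G)) (skeleton O).

Lemma act_square x y w v (p : @gpath (skeleton L) x y)
    (q : @gpath (skeleton G) w v) :
  square (pcomp (slice1 phi w) p) (pcomp (slice2 phi y) q)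
    (pcomp (slice2 phi x) (actR phi p q)) (pcomp (slice1 phi v) (actL phi p q)).
Proof.
split; first exact: swap_composable.
- by rewrite pcomp_s pcomp_r.
- exact: act_comp.
- by rewrite !pcomp_d (actLP phi p q).1.
- by rewrite !pcomp_d (actRP phi p q).1.
Qed.

(** This allows arguing on classes by uniqueness of squares, without choosing a representative path.
    The side opposite to [q] depends on [a], so it is only asserted to exist. *)
Lemma hatL_square w v (q : @gpath (skeleton G) w v) (a : fiber1 phi w) :
  exists q' : @gpath (skeleton G) w v,
    square (val a) (pcomp (slice2 phi (fiber_s a)) q)
      (pcomp (slice2 phi (fiber_r a)) q') (val (hatL q a)).
Proof.
elim/fiber_elim: a => x y p; rewrite pclass_r pclass_s.
by exists (actR phi p q); have /= -> := hatLE phi q p; exact: act_square.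
Qed.

Section Left.
Variables (w v : kobj G) (q : @gpath (skeleton G) w v).

Lemma hatL_r (a : fiber1 phi w) : fiber_r (hatL q a) = fiber_r a.
Proof.
have [q' [_ c _ _ _]] := hatL_square q a.
apply: (@sl_v_inj _ _ _ _ (slice1 phi v)).
by rewrite -fiber_rE -c pcomp_s.
Qed.

Lemma hatL_s (a : fiber1 phi w) : fiber_s (hatL q a) = fiber_s a.
Proof.
have [q' /square_s h] := hatL_square q a.
apply: (@sl_v_inj _ _ _ _ (slice1 phi v)).
by rewrite -fiber_sE h pcomp_s.
Qed.

Lemma hatL_morphic :
  (forall q' : @gpath (skeleton G) w v, hatL (phi := phi) q =1 hatL q') ->
  @kmorphic _ (fiber1_kgraph phi w) (fiber1_kgraph phi v) id (hatL q).
Proof.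
move=> par; split=> [a|a|a|a a' c]; [exact: hatL_r|exact: hatL_s| |].
  have [q' [_ _ _ e _]] := hatL_square q a.
  by rewrite /= /fiber_deg e.
rewrite /= in c *.
have [q1 sq1] := hatL_square q a'.
have [q2 sq2] := hatL_square q (fiber_comp a a').
(* Crossing [a'] turns [q] into [q1], so the square that can be pasted next to it is that of
   [hatL q1 a]; [par] replaces this by [hatL q a]. *)
have [q3] : exists q3 : @gpath (skeleton G) w v,
    square (val a) (pcomp (slice2 phi (fiber_s a)) q1)
      (pcomp (slice2 phi (fiber_r a)) q3) (val (hatL q a)).
  by rewrite (par q1); exact: hatL_square.
rewrite c => sq3.
have c' : ks (val a) = kr (val a') by apply/fiber_composable.
have s' : fiber_s (fiber_comp a a') = fiber_s a'.
  exact: (@ks_comp _ (fiber1_kgraph phi w)).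
apply: val_inj; rewrite fiber_compE //; last by rewrite hatL_s hatL_r.
have := square_comp_l c' sq1 sq3.
rewrite -fiber_compE // -s' => /(square_uniq sq2)[_ //].
Qed.

End Left.

Lemma hatL_nil w (a : fiber1 phi w) :
  hatL (gnil (G := skeleton G) w) a = a.
Proof.
have [q' sq] := hatL_square (gnil (G := skeleton G) w) a; apply: val_inj.
have e : slice2_v phi (fiber_s a) w = ks (val a) by rewrite fiber_sE.
by move: sq; rewrite /= e => /square_uniq/(_ (square_id_r _))[].
Qed.

(** The squares of [f] and of [q] share the side [hatL (gpath1 f) a], and pasting them along it
    gives a square for the whole path. *)
Lemma hatL_cons f v (q : @gpath (skeleton G) (gsrc f) v)
    (a : fiber1 phi (grng f)) :
  hatL (gcons (G := skeleton G) f q) a = hatL q (hatL (gpath1 f) a).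
Proof.
have [q0 sq0] := hatL_square (gcons (G := skeleton G) f q) a.
have [q1 sq1] := hatL_square (gpath1 f) a.
have [q2 sq2] := hatL_square q (hatL (gpath1 f) a).
apply: val_inj; rewrite hatL_s in sq2.
have c : ks (pcomp (slice2 phi (fiber_s a)) (gpath1 f)) =
  kr (pcomp (slice2 phi (fiber_s a)) q) by rewrite pcomp_s pcomp_r.
have := square_comp_r c sq1 sq2.
have -> : kcomp (pcomp (slice2 phi (fiber_s a)) (gpath1 f))
    (pcomp (slice2 phi (fiber_s a)) q) =
  pcomp (slice2 phi (fiber_s a)) (gcons (G := skeleton G) f q).
  rewrite /=; congr kcomp.
  by rewrite -[slice2_v _ _ _](slice2_s phi (fiber_s a)) kcompm1.
by move=> /(square_uniq sq0)[].
Qed.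

Lemma hatR_square x y (p : @gpath (skeleton L) x y) (b : fiber2 phi y) :
  exists p' : @gpath (skeleton L) x y,
    square (pcomp (slice1 phi (fiber_r b)) p) (val b) (val (hatR p b))
      (pcomp (slice1 phi (fiber_s b)) p').
Proof.
elim/fiber_elim: b => w v q; rewrite pclass_r pclass_s.
by exists (actL phi p q); have /= -> := hatRE phi p q; exact: act_square.
Qed.

Section Right.
Variables (x y : kobj L) (p : @gpath (skeleton L) x y).

Lemma hatR_r (b : fiber2 phi y) : fiber_r (hatR p b) = fiber_r b.
Proof.
have [p' /square_r h] := hatR_square p b.
apply: (@sl_v_inj _ _ _ _ (slice2 phi x)).
by rewrite -fiber_rE h pcomp_r.
Qed.

Lemma hatR_s (b : fiber2 phi y) : fiber_s (hatR p b) = fiber_s b.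
Proof.
have [p' [_ c _ _ _]] := hatR_square p b.
apply: (@sl_v_inj _ _ _ _ (slice2 phi x)).
by rewrite -fiber_sE c pcomp_r.
Qed.

Lemma hatR_morphic :
  (forall p' : @gpath (skeleton L) x y, hatR (phi := phi) p =1 hatR p') ->
  @kmorphic _ (fiber2_kgraph phi y) (fiber2_kgraph phi x) id (hatR p).
Proof.
move=> par; split=> [b|b|b|b b' c]; [exact: hatR_r|exact: hatR_s| |].
  have [p' [_ _ _ _ e]] := hatR_square p b.
  by rewrite /= /fiber_deg e.
rewrite /= in c *.
have [p1 sq1] := hatR_square p b.
have [p2 sq2] := hatR_square p (fiber_comp b b').
(* Here [b] is crossed first and turns [p] into [p1]; [par] is then used for the hat of [b']. *)
have [p3] : exists p3 : @gpath (skeleton L) x y,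
    square (pcomp (slice1 phi (fiber_r b')) p1) (val b') (val (hatR p b'))
      (pcomp (slice1 phi (fiber_s b')) p3).
  by rewrite (par p1); exact: hatR_square.
rewrite -c => sq3.
have c' : ks (val b) = kr (val b') by apply/fiber_composable.
have r' : fiber_r (fiber_comp b b') = fiber_r b.
  exact: (@kr_comp _ (fiber2_kgraph phi y)).
apply: val_inj; rewrite fiber_compE //; last by rewrite hatR_s hatR_r.
have := square_comp_r c' sq1 sq3.
rewrite -fiber_compE // -r' => /(square_uniq sq2)[-> //].
Qed.

End Right.

Lemma hatR_nil x (b : fiber2 phi x) :
  hatR (gnil (G := skeleton L) x) b = b.
Proof.
have [p' sq] := hatR_square (gnil (G := skeleton L) x) b; apply: val_inj.
have e : slice1_v phi (fiber_r b) x = kr (val b) by rewrite fiber_rE.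
by move: sq; rewrite /= e => /square_uniq/(_ (square_id_l _))[].
Qed.

Lemma hatR_cons e y (p : @gpath (skeleton L) (gsrc e) y) (b : fiber2 phi y) :
  hatR (gcons (G := skeleton L) e p) b = hatR (gpath1 e) (hatR p b).
Proof.
have [p0 sq0] := hatR_square (gcons (G := skeleton L) e p) b.
have [p1 sq1] := hatR_square p b.
have [p2 sq2] := hatR_square (gpath1 e) (hatR p b).
apply: val_inj; rewrite hatR_r in sq2.
have c : ks (pcomp (slice1 phi (fiber_r b)) (gpath1 e)) =
  kr (pcomp (slice1 phi (fiber_r b)) p) by rewrite pcomp_s pcomp_r.
have := square_comp_l c sq1 sq2.
have -> : kcomp (pcomp (slice1 phi (fiber_r b)) (gpath1 e))
    (pcomp (slice1 phi (fiber_r b)) p) =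
  pcomp (slice1 phi (fiber_r b)) (gcons (G := skeleton L) e p).
  rewrite /=; congr kcomp.
  by rewrite -[slice1_v _ _ _](slice1_s phi (fiber_r b)) kcompm1.
by move=> /(square_uniq sq0)[].
Qed.

End Hats.

(** * Isomorphisms onto a product from two coordinates *)

Lemma kcompAA k (A : kgraph k) (a b c d : kmor A) :
  ks a = kr b -> ks b = kr c -> ks c = kr d ->
  kcomp (kcomp a b) (kcomp c d) = kcomp (kcomp a (kcomp b c)) d.
Proof. by move=> ab bc cd; rewrite kcompA ?ks_comp // (kcompA ab). Qed.

Section Coordinates.

(* In a product M x M', the conditions satisfied by the projection t to M,    *)
(* restricted to the morphisms (la, v) with v an object of M'; here inn maps  *)
(* the degree of la to that of (la, v), and o and o' give the coordinates of  *)
(* the objects.                                                               *)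
Record coordinate k l (O : kgraph l) (M : kgraph k) (I : Type)
    (inn : 'rV[nat]_k -> 'rV[nat]_l) (o : kobj O -> kobj M) (o' : kobj O -> I)
    (t : kmor O -> kmor M) : Prop := Coordinate {
  coord_r : forall m mu, kdeg mu = inn m -> kr (t mu) = o (kr mu);
  coord_s : forall m mu, kdeg mu = inn m -> ks (t mu) = o (ks mu);
  coord_d : forall m mu, kdeg mu = inn m -> kdeg (t mu) = m;
  coord_const : forall m mu, kdeg mu = inn m -> o' (ks mu) = o' (kr mu);
  coord_comp : forall m n mu nu, kdeg mu = inn m -> kdeg nu = inn n ->
    ks mu = kr nu -> t (kcomp mu nu) = kcomp (t mu) (t nu);
  coord_inj : forall m n mu nu, kdeg mu = inn m -> kdeg nu = inn n ->
    o' (kr mu) = o' (kr nu) -> t mu = t nu -> mu = nu;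
  coord_surj : forall (la : kmor M) (i : I), exists mu,
    [/\ kdeg mu = inn (kdeg la), o' (kr mu) = i & t mu = la]
}.

Variables (k1 k2 : nat) (O : kgraph (k1 + k2)) (L : kgraph k1) (G : kgraph k2).
Variables (o1 : kobj O -> kobj L) (o2 : kobj O -> kobj G).
Variables (t1 : kmor O -> kmor L) (t2 : kmor O -> kmor G).
Hypothesis o_bij : bijective (fun v => (o1 v, o2 v)).
Hypothesis C1 : coordinate (fun m => row_mx m 0) o1 o2 t1.
Hypothesis C2 : coordinate (fun n => row_mx 0 n) o2 o1 t2.
Hypothesis square_coord : forall m n al be be' al', square al be be' al' ->
  kdeg al = row_mx m 0 -> kdeg be = row_mx 0 n ->
  t1 al' = t1 al /\ t2 be' = t2 be.

Lemma kdeg_split (mu : kmor O) :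
  kdeg mu = row_mx (lsubmx (kdeg mu)) 0 + row_mx 0 (rsubmx (kdeg mu)).
Proof. by rewrite add_row_mx addr0 add0r hsubmxK. Qed.

Definition coord_pair (mu : kmor O) : kmor (kprod L G) :=
  (t1 (kfactor (kdeg_split mu)).1, t2 (kfactor (kdeg_split mu)).2).

Lemma coord_pairE m n al be : kdeg al = row_mx m 0 -> kdeg be = row_mx 0 n ->
  ks al = kr be -> coord_pair (kcomp al be) = (t1 al, t2 be).
Proof.
move=> da db c; rewrite /coord_pair.
have [c' e d1 d2] := kfactorP (kdeg_split (kcomp al be)).
have [] := kcompI c c' _ _ e; last by move=> <- <-.
  by rewrite d1 da kdeg_comp // da db add_row_mx row_mxKl addr0.
by rewrite d2 db kdeg_comp // da db add_row_mx row_mxKr add0r.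
Qed.

Lemma row_split (mu : kmor O) : exists m n al be,
  [/\ mu = kcomp al be, ks al = kr be, kdeg al = row_mx m 0 &
      kdeg be = row_mx 0 n].
Proof.
have [c e d1 d2] := kfactorP (kdeg_split mu).
by exists (lsubmx (kdeg mu)), (rsubmx (kdeg mu)), (kfactor (kdeg_split mu)).1,
  (kfactor (kdeg_split mu)).2.
Qed.

(** For multiplicativity, the inner part [be al'] of [(al be) (al' be')] is rewritten as [al2 be2],
    which brings the factors of the same kind together; [square_coord] says that this interchange
    preserves both coordinates. *)
Lemma coord_pair_morphic :
  @kmorphic _ O (kprod L G) (fun v => (o1 v, o2 v)) coord_pair.
Proof.
split=> [mu|mu|mu|mu mu'].
- have [m [n [al [be [-> c da db]]]]] := row_split mu.
  rewrite (coord_pairE da db c) kr_comp //= /prod_r /=.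
  by rewrite (coord_r C1 da) (coord_r C2 db) -c (coord_const C1 da).
- have [m [n [al [be [-> c da db]]]]] := row_split mu.
  rewrite (coord_pairE da db c) ks_comp //= /prod_s /=.
  by rewrite (coord_s C1 da) (coord_s C2 db) c (coord_const C2 db).
- have [m [n [al [be [-> c da db]]]]] := row_split mu.
  rewrite (coord_pairE da db c) kdeg_comp //= /prod_deg /=.
  by rewrite (coord_d C1 da) (coord_d C2 db) da db add_row_mx addr0 add0r.
have [m [n [al [be [-> c da db]]]]] := row_split mu.
have [m' [n' [al' [be' [-> c' da' db']]]]] := row_split mu'.
rewrite ks_comp // kr_comp // => cc.
have [al2 [be2 sq]] := square_exists cc.
have sq' := square_sym sq.
have [_ cc2 e d2 f2] := sq.
have [e1 e2] := square_coord sq' (etrans f2 da') (etrans d2 db).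
have r2 := square_r sq; have s2 := square_s sq.
have c1 : ks al = kr al2 by rewrite r2.
have c2 : ks be2 = kr be' by rewrite s2.
have -> : kcomp (kcomp al be) (kcomp al' be') =
    kcomp (kcomp al al2) (kcomp be2 be').
  by rewrite (kcompAA c cc c') e (kcompAA c1 cc2 c2).
rewrite (@coord_pairE (m + m') (n + n')) ?kdeg_comp //.
- rewrite (coord_pairE da db c) (coord_pairE da' db' c') /= /prod_comp /=.
  rewrite (coord_comp C1 da (etrans f2 da') c1).
  by rewrite (coord_comp C2 (etrans d2 db) db' c2) e1 e2.
- by rewrite da f2 da' add_row_mx addr0.
- by rewrite d2 db db' add_row_mx addr0.
- by rewrite ks_comp // kr_comp.
Qed.

(** [al] is known from [t1 al] and the constant value of [o2] along it, which is the range of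
    [t2 be]; likewise [o1] along [be] is the source of [t1 al]. Prescribing these two values makes
    the lifts composable in the surjectivity part. *)
Lemma coord_pair_bij : bijective coord_pair.
Proof.
apply: inj_surj_bij => [mu mu'|[la ga]].
  have [m [n [al [be [-> c da db]]]]] := row_split mu.
  have [m' [n' [al' [be' [-> c' da' db']]]]] := row_split mu'.
  rewrite (coord_pairE da db c) (coord_pairE da' db' c') => -[e1 e2].
  have -> : al = al'.
    apply: (coord_inj C1 da da' _ e1).
    rewrite -(coord_const C1 da) -(coord_const C1 da') c c'.
    by rewrite -(coord_r C2 db) -(coord_r C2 db') e2.
  suff -> : be = be' by [].
  apply: (coord_inj C2 db db' _ e2).
  by rewrite -c -c' -(coord_s C1 da) -(coord_s C1 da') e1.
have [al [da ia ta]] := coord_surj C1 la (kr ga).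
have [be [db ib tb]] := coord_surj C2 ga (ks la).
have c : ks al = kr be.
  apply: (bij_inj o_bij) => /=.
  by rewrite (coord_const C1 da) ia -(coord_s C1 da) ta ib -(coord_r C2 db) tb.
by exists (kcomp al be); rewrite (coord_pairE da db c) ta tb.
Qed.

Lemma coordinates_kiso : kiso O (kprod L G).
Proof. exact: kmorphic_kiso coord_pair_morphic o_bij coord_pair_bij. Qed.

End Coordinates.

Lemma kiso_prod k1 k2 (A A' : kgraph k1) (B B' : kgraph k2) :
  kiso A A' -> kiso B B' -> kiso (kprod A B) (kprod A' B').
Proof.
move=> /kiso_kmorphic[o [h [[r s d c] ob hb]]].
move=> /kiso_kmorphic[o' [h' [[r' s' d' c'] ob' hb']]].
apply: (@kmorphic_kiso _ (kprod A B) (kprod A' B') _ _ _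
  (bij_prod ob ob') (bij_prod hb hb')).
split=> [[a b]|[a b]|[a b]|[a b] [a' b'] [c1 c2]] /=.
- by rewrite /prod_r /= r r'.
- by rewrite /prod_s /= s s'.
- by rewrite /prod_deg /= d d'.
- by rewrite /prod_comp /= c // c'.
Qed.

(** * Coordinates glued from maps on the fibers *)

Section FiberCoordinate.
Variables (k l : nat) (L : kgraph k) (O : kgraph l) (M : kgraph k).
Variables (I : Type) (S : I -> slice L O) (inn : 'rV[nat]_k -> 'rV[nat]_l).
Variables (ix : kobj O -> I) (vx : kobj O -> kobj L) (o : kobj L -> kobj M).
Variable T : forall i, fiber (S i) -> kmor M.
Hypothesis inn_inj : injective inn.
Hypothesis innE : forall i m, sl_in (S i) m = inn m.
Hypothesis sl_vK : forall v, sl_v (S (ix v)) (vx v) = v.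
Hypothesis ixK : forall i x, ix (sl_v (S i) x) = i.
Hypothesis vxK : forall i x, vx (sl_v (S i) x) = x.
Hypothesis T_morphic : forall i, @kmorphic _ (fiber_kgraph (S i)) M o (@T i).
Hypothesis T_bij : forall i, bijective (@T i).

(** The default of [insubd] makes this total on Omega. By [fiber_lift] it does not occur for arrows
    whose degree is in the image of [inn]. *)
Definition fiber_coord (mu : kmor O) : kmor M :=
  T (insubd (fiber_id (S (ix (kr mu))) (vx (kr mu))) mu).

Lemma fiber_coordE i (a : fiber (S i)) : fiber_coord (val a) = T a.
Proof.
rewrite /fiber_coord; move: (vx _).
have : ix (kr (val a)) = i by rewrite fiber_rE ixK.
(* [a] has index [i], while the definition uses the index of its range; generalizing the latter lets
   the two be identified without a cast. *)
by move: (ix _) => j ej x; subst j; rewrite valKd.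
Qed.

Lemma fiber_lift m mu i : kdeg mu = inn m -> ix (kr mu) = i ->
  exists a : fiber (S i), val a = mu.
Proof.
move=> d <-; have h : in_fiber (S (ix (kr mu))) mu.
  by apply/in_fiberP; split; [exists m; rewrite innE | exists (vx (kr mu))].
by exists (to_fiber h).
Qed.

Lemma fiber_coordinate : coordinate inn (o \o vx) ix fiber_coord.
Proof.
have degE i (a : fiber (S i)) m : kdeg (val a) = inn m -> fiber_deg a = m.
  by rewrite fiber_degE innE => /inn_inj.
split=> [m mu d|m mu d|m mu d|m mu d|m n mu nu d d' c|m n mu nu d d' e|la i].
- have [a ea] := fiber_lift d erefl; rewrite -ea fiber_coordE.
  by have [-> _ _ _] := T_morphic (ix (kr mu)); rewrite /= fiber_rE vxK.
- have [a ea] := fiber_lift d erefl; rewrite -ea fiber_coordE.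
  by have [_ -> _ _] := T_morphic (ix (kr mu)); rewrite /= fiber_sE vxK.
- have [a ea] := fiber_lift d erefl; rewrite -ea fiber_coordE.
  have [_ _ -> _] := T_morphic (ix (kr mu)); apply: degE.
  by rewrite ea.
- have [a <-] := fiber_lift d erefl.
  by rewrite [in LHS]fiber_sE [in RHS]fiber_rE !ixK.
- have [i ei] : exists i, ix (kr mu) = i by eexists.
  have [a ea] := fiber_lift d ei; subst mu.
  have [b eb] : exists b : fiber (S i), val b = nu.
    by apply: fiber_lift d' _; rewrite -c fiber_sE ixK.
  subst nu; have c' : fiber_s a = fiber_r b by apply/fiber_composable.
  rewrite -(fiber_compE c') !fiber_coordE.
  by have [_ _ _ hc] := T_morphic i; exact: (hc a b c').
- have [i ei] : exists i, ix (kr nu) = i by eexists.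
  rewrite ei in e.
  have [a <-] := fiber_lift d e; have [b <-] := fiber_lift d' ei.
  by rewrite !fiber_coordE => /(bij_inj (T_bij _)) ->.
- have [a ea] := bij_surj (T_bij i) la; exists (val a).
  rewrite fiber_coordE ea fiber_degE innE fiber_rE ixK; split=> //.
  by have [_ _ hd _] := T_morphic i; rewrite -ea hd.
Qed.

End FiberCoordinate.

(** * Transport of fibers along walks to a base vertex *)

Section Transport.
Variables (k1 k2 : nat) (L : kgraph k1) (G : kgraph k2) (O : kgraph (k1 + k2)).
Variable phi : cgraph_iso (skeleton (kprod L G)) (skeleton O).

Section WalkLeft.
Hypothesis bij :
  forall f : gedge (skeleton G), bijective (hatL (phi := phi) (gpath1 f)).

Lemma walkL_bij w v (ze : @gpath (double (skeleton G)) w v) :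
  bijective (walkL bij ze).
Proof.
elim: ze => [w0|[f b] v0 ze IH] /=; first by exists id.
apply: (bij_comp IH); case: b {IH ze} => /=; [exact: bij | exact: bij_inv_bij].
Qed.

Lemma walkL_morphic w v (ze : @gpath (double (skeleton G)) w v) :
  (forall f : gedge (skeleton G), @kmorphic _
     (fiber1_kgraph phi (grng f)) (fiber1_kgraph phi (gsrc f)) id
     (hatL (gpath1 f))) ->
  @kmorphic _ (fiber1_kgraph phi w) (fiber1_kgraph phi v) id (walkL bij ze).
Proof.
move=> hm; elim: ze => [w0|[f b] v0 ze IH]; first exact: kmorphic_id.
apply: kmorphic_comp IH; case: b ze => _ /=; first exact: hm.
by apply: kmorphic_inv (hm f) _ (bij_inj (bij f)) (bij_invK (bij f)).
Qed.

End WalkLeft.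

(** [T w] is the map of a chosen walk from [w] to [w0]. Prepending an edge to the walk chosen at its
    source gives a walk with the same ends as the one chosen at its range, so by path independence
    [T] absorbs the hats. *)
Lemma relaxed_stable1_transport w0 :
  connected (skeleton G) -> relaxed_stable1 phi ->
  exists T : forall w, fiber1 phi w -> fiber1 phi w0,
    [/\ forall w, bijective (T w),
        forall w, @kmorphic _ (fiber1_kgraph phi w) (fiber1_kgraph phi w0)
          id (T w) &
        forall w v (q : @gpath (skeleton G) w v) a, T v (hatL q a) = T w a].
Proof.
move=> conn [bij indep].
have walk w : exists _ : @gpath (double (skeleton G)) w w0, True.
  by case: (conn w w0) => ze; exists ze.
pose T w := walkL (fun f => bij _ _ (gpath1 f)) (sval (cid (walk w))).
have T_bij w : bijective (T w) by exact: walkL_bij.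
have T_hat w v (q : @gpath (skeleton G) w v) a : T v (hatL q a) = T w a.
  elim: q a => [u|f u q IH] a; first by rewrite hatL_nil.
  rewrite hatL_cons IH.
  exact: (indep _ _
    (gcons (G := double (skeleton G)) (f, true) (sval (cid (walk (gsrc f)))))).
(* Since [T] absorbs all hats and is injective, parallel paths have equal hats, as [hatL_morphic]
   requires. *)
exists T; split=> // w; apply: walkL_morphic => f; apply: hatL_morphic => q' a.
by apply: (bij_inj (T_bij (gsrc f))); rewrite !T_hat.
Qed.

Section WalkRight.
Hypothesis bij :
  forall e : gedge (skeleton L), bijective (hatR (phi := phi) (gpath1 e)).

Lemma walkR_bij x y (xi : @gpath (double (skeleton L)) x y) :
  bijective (walkR bij xi).
Proof.
elim: xi => [x0|[e b] y0 xi IH] /=; first by exists id.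
apply: bij_comp IH; case: b {xi} => /=; [exact: bij | exact: bij_inv_bij].
Qed.

Lemma walkR_morphic x y (xi : @gpath (double (skeleton L)) x y) :
  (forall e : gedge (skeleton L), @kmorphic _
     (fiber2_kgraph phi (gsrc e)) (fiber2_kgraph phi (grng e)) id
     (hatR (gpath1 e))) ->
  @kmorphic _ (fiber2_kgraph phi y) (fiber2_kgraph phi x) id (walkR bij xi).
Proof.
move=> hm; elim: xi => [x0|[e b] y0 xi IH]; first exact: kmorphic_id.
have hb : @kmorphic _ (fiber2_kgraph phi (@gsrc (double (skeleton L)) (e, b)))
    (fiber2_kgraph phi (@grng (double (skeleton L)) (e, b))) id
    (walkR1 bij (eb := (e, b))).
  case: b {xi IH} => /=; first exact: hm.
  by apply: kmorphic_inv (hm e) _ (bij_inj (bij e)) (bij_invK (bij e)).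
exact: kmorphic_comp IH hb.
Qed.

End WalkRight.

Lemma relaxed_stable2_transport x0 :
  connected (skeleton L) -> relaxed_stable2 phi ->
  exists T : forall x, fiber2 phi x -> fiber2 phi x0,
    [/\ forall x, bijective (T x),
        forall x, @kmorphic _ (fiber2_kgraph phi x) (fiber2_kgraph phi x0)
          id (T x) &
        forall x y (p : @gpath (skeleton L) x y) b, T x (hatR p b) = T y b].
Proof.
move=> conn [bij indep].
have walk x : exists _ : @gpath (double (skeleton L)) x x0, True.
  by case: (conn x x0) => xi; exists xi.
(* [hatR] maps the fiber at the source to the fiber at the range, so a walk from [x] to [x0] acts
   out of the base fiber; the transport is the inverse of [U x]. *)
pose U x := walkR (fun e => bij _ _ (gpath1 e)) (sval (cid (walk x))).
have U_bij x : bijective (U x) by exact: walkR_bij.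
have U_hat x y (p : @gpath (skeleton L) x y) b : hatR p (U y b) = U x b.
  elim: p b => [u|e u p IH] b; first by rewrite hatR_nil.
  rewrite hatR_cons IH.
  exact: (indep _ _
    (gcons (G := double (skeleton L)) (e, true) (sval (cid (walk (gsrc e)))))).
exists (fun x => bij_inv (U_bij x)); split=> [x|x|x y p b].
- exact: bij_inv_bij.
- suff Um : @kmorphic _ (fiber2_kgraph phi x0) (fiber2_kgraph phi x) id (U x).
    by apply: kmorphic_inv Um _ (bij_inj (U_bij x)) (bij_invK (U_bij x)).
  apply: walkR_morphic => e; apply: hatR_morphic => p' b.
  by rewrite -(bij_invK (U_bij (gsrc e)) b) !U_hat.
- apply: (bij_inj (U_bij x)).
  by rewrite bij_invK -(U_hat _ _ p) bij_invK.
Qed.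

End Transport.

(** * From relaxed stability to a product decomposition *)

Section Equivalence.
Variables (k1 k2 : nat) (L : kgraph k1) (G : kgraph k2) (O : kgraph (k1 + k2)).
Variable phi : cgraph_iso (skeleton (kprod L G)) (skeleton O).
Hypothesis L_connected : connected (skeleton L).
Hypothesis G_connected : connected (skeleton G).

Lemma relaxed_stable_kiso w0 x0 : relaxed_stable1 phi -> relaxed_stable2 phi ->
  kiso O (kprod (fiber1_kgraph phi w0) (fiber2_kgraph phi x0)).
Proof.
move=> /(relaxed_stable1_transport w0 G_connected)[T1 [T1_bij T1_mor T1_hat]].
move=> /(relaxed_stable2_transport x0 L_connected)[T2 [T2_bij T2_mor T2_hat]].
have [vinv vK Kv] := iso_v_bij phi.
pose o1 v := (vinv v).1; pose o2 v := (vinv v).2.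
have ov v : iso_v phi (o1 v, o2 v) = v by rewrite -surjective_pairing Kv.
have o1K x w : o1 (iso_v phi (x, w)) = x by rewrite /o1 vK.
have o2K x w : o2 (iso_v phi (x, w)) = w by rewrite /o2 vK.
have inj1 : injective (fun m : 'rV[nat]_k1 => row_mx m (0 : 'rV_k2)).
  by move=> m n /eq_row_mx[].
have inj2 : injective (fun n : 'rV[nat]_k2 => row_mx (0 : 'rV_k1) n).
  by move=> m n /eq_row_mx[].
have sl1 w m : sl_in (slice1 phi w) m = row_mx m 0 by [].
have sl2 x n : sl_in (slice2 phi x) n = row_mx 0 n by [].
have C1 := @fiber_coordinate _ _ _ _ (fiber1_kgraph phi w0) _ (slice1 phi)
  _ o2 o1 id T1 inj1 sl1 ov (fun w x => o2K x w) (fun w x => o1K x w)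
  T1_mor T1_bij.
have C2 := @fiber_coordinate _ _ _ _ (fiber2_kgraph phi x0) _ (slice2 phi)
  _ o1 o2 id T2 inj2 sl2 ov o1K o2K T2_mor T2_bij.
have t1E w (a : fiber1 phi w) :
    fiber_coord (M := fiber1_kgraph phi w0) o2 o1 T1 (val a) = T1 w a.
  by apply: fiber_coordE => w' x; exact: o2K.
have t2E x (b : fiber2 phi x) :
    fiber_coord (M := fiber2_kgraph phi x0) o1 o2 T2 (val b) = T2 x b.
  by apply: fiber_coordE => x' w; exact: o1K.
apply: (@coordinates_kiso _ _ O (fiber1_kgraph phi w0) (fiber2_kgraph phi x0)
  o1 o2 _ _ _ C1 C2) => [|m n al be be' al' sq da db].
  by exists (fun v => iso_v phi v) => [v|[x w]] /=; rewrite ?ov ?o1K ?o2K.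
(* It remains to see that interchange preserves the coordinates. By uniqueness the given square is
   the one defining the actions of representing paths [p] and [q], so its new sides are images under
   hats, which transport absorbs. *)
have [a ea] := fiber_lift sl1 ov da erefl.
have [b eb] := fiber_lift sl2 ov db erefl.
move: a b ea eb; move: (o2 _) (o1 _) => w y a b ea eb.
subst al be; move: sq {da db}.
elim/fiber_elim: a => x y' p; elim/fiber_elim: b => w' v q sq.
have [] : y' = y /\ w = w'.
  by case: sq; rewrite /= pcomp_s pcomp_r => /(bij_inj (iso_v_bij phi))[].
move=> ? ?; subst y' w'.
have [-> ->] := square_uniq sq (act_square phi p q).
have -> : pcomp (slice1 phi v) (actL phi p q) =
    val (class1 phi v (actL phi p q)).
  by [].
have -> : pcomp (slice2 phi x) (actR phi p q) =
    val (class2 phi x (actR phi p q)).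
  by [].
by rewrite -hatLE -hatRE !t1E !t2E T1_hat T2_hat.
Qed.

(** * From an isomorphism to relaxed stability *)

Section Converse.
Variable F : kfunctor O (kprod L G).
Hypothesis Fo_bij : bijective (fobj F).
Hypothesis Fm_bij : bijective (fmor F).
Hypothesis F_deg : forall mu, kdeg (fmor F mu) = kdeg mu.

Lemma fmor_snd_id mu m : kdeg mu = row_mx m 0 ->
  (fmor F mu).2 = kid (fobj F (kr mu)).2.
Proof.
rewrite -fmor_r -F_deg /= /prod_deg => /eq_row_mx[_ d].
by apply/(kdeg0 _).1.
Qed.

Lemma fmor_fst_id mu n : kdeg mu = row_mx 0 n ->
  (fmor F mu).1 = kid (fobj F (kr mu)).1.
Proof.
rewrite -fmor_r -F_deg /= /prod_deg => /eq_row_mx[d _].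
by apply/(kdeg0 _).1.
Qed.

Lemma fmor_snd_id_s mu m : kdeg mu = row_mx m 0 ->
  (fmor F mu).2 = kid (fobj F (ks mu)).2.
Proof. by move=> /fmor_snd_id h; rewrite -fmor_s /= h ks_id. Qed.

Lemma fmor_fst_id_s mu n : kdeg mu = row_mx 0 n ->
  (fmor F mu).1 = kid (fobj F (ks mu)).1.
Proof. by move=> /fmor_fst_id h; rewrite -fmor_s /= h ks_id. Qed.

(** [F] sends an edge of Lambda x {w} to an arrow whose second component is an identity, so the two
    ends of the edge agree in that component, and Lambda is connected. *)
Lemma fobj_snd_const w x x' :
  (fobj F (iso_v phi (x, w))).2 = (fobj F (iso_v phi (x', w))).2.
Proof.
apply: (@connected_const (skeleton L) _
  (fun x => (fobj F (iso_v phi (x, w))).2) L_connected) => e.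
have := slice1_r phi w e; have := slice1_s phi w e.
rewrite /slice1_v /= => <- <-.
have /fmor_snd_id h := slice1_d phi w e.
by rewrite -[in RHS]fmor_s /= h ks_id.
Qed.

Lemma fobj_fst_const x w w' :
  (fobj F (iso_v phi (x, w))).1 = (fobj F (iso_v phi (x, w'))).1.
Proof.
apply: (@connected_const (skeleton G) _
  (fun w => (fobj F (iso_v phi (x, w))).1) G_connected) => f.
have := slice2_r phi x f; have := slice2_s phi x f.
rewrite /slice2_v /= => <- <-.
have /fmor_fst_id h := slice2_d phi x f.
by rewrite -[in RHS]fmor_s /= h ks_id.
Qed.

Definition fiber1_fst w (a : fiber1 phi w) : kmor L := (fmor F (val a)).1.
Definition fiber2_snd x (b : fiber2 phi x) : kmor G := (fmor F (val b)).2.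

Lemma fiber1_fst_bij w : bijective (@fiber1_fst w).
Proof.
apply: inj_surj_bij => [a a' e|la].
  apply: val_inj; apply: (bij_inj Fm_bij).
  rewrite [LHS]surjective_pairing [RHS]surjective_pairing.
  congr pair; first exact: e.
  rewrite (fmor_snd_id (fiber_degE a)) (fmor_snd_id (fiber_degE a')).
  by rewrite !fiber_rE /= /slice1_v (fobj_snd_const w (fiber_r a) (fiber_r a')).
have [vinv _ Kv] := iso_v_bij phi.
(* The [w] in this target is an arbitrary vertex of Gamma: only the first label [x] of the preimage
   is kept. By [fobj_fst_const], the image of [(x, w)] still has first component [kr la]. *)
have [v ev] := bij_surj Fo_bij (kr la, w).
pose x := (vinv v).1.
have [mu emu] := bij_surj Fm_bij (la, kid (fobj F (iso_v phi (x, w))).2).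
have d : kdeg mu = row_mx (kdeg la) 0.
  by rewrite -F_deg emu /= /prod_deg /= kdeg_id.
have r : kr mu = iso_v phi (x, w).
  apply: (bij_inj Fo_bij); rewrite -fmor_r emu /= /prod_r /= kr_id.
  rewrite [RHS]surjective_pairing (fobj_fst_const x w (vinv v).2).
  by rewrite -surjective_pairing Kv ev.
have h : in_fiber (slice1 phi w) mu.
  by apply/in_fiberP; split; [exists (kdeg la) | exists x].
by exists (to_fiber h); rewrite /fiber1_fst /= emu.
Qed.

(** Under the first component of [F], the two sides of the square lying in Omega_2 become
    identities. *)
Lemma fiber1_fst_hat w v (q : @gpath (skeleton G) w v) a :
  fiber1_fst (hatL q a) = fiber1_fst a.
Proof.
have [q' [c c' e _ _]] := hatL_square q a.
have := congr1 (fun mu => (fmor F mu).1) e; rewrite !fmor_comp //=.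
rewrite (fmor_fst_id (pcomp_d (slice2 phi _) q)).
rewrite (fmor_fst_id_s (pcomp_d (slice2 phi _) q')) c' -c.
by rewrite -fmor_s -fmor_r /= kcompm1 kcomp1m.
Qed.

Lemma walkL_fst
    (bij : forall f : gedge (skeleton G),
      bijective (hatL (phi := phi) (gpath1 f)))
    w v (ze : @gpath (double (skeleton G)) w v) a :
  fiber1_fst (walkL bij ze a) = fiber1_fst a.
Proof.
elim: ze a => [//|[f b] u ze IH] a; rewrite /= IH; case: b ze {IH} a => _ a /=.
  exact: fiber1_fst_hat.
by rewrite -[in RHS](bij_invK (bij f) a) fiber1_fst_hat.
Qed.

Lemma morphic_relaxed_stable1 : relaxed_stable1 phi.
Proof.
have bij w v (q : @gpath (skeleton G) w v) : bijective (hatL (phi := phi) q).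
  exact: bij_factor (fiber1_fst_bij v) (fiber1_fst_bij w) (fiber1_fst_hat q).
exists bij => w v ze ze' a.
by apply: (bij_inj (fiber1_fst_bij v)); rewrite !walkL_fst.
Qed.

Lemma fiber2_snd_bij x : bijective (@fiber2_snd x).
Proof.
apply: inj_surj_bij => [b b' e|ga].
  apply: val_inj; apply: (bij_inj Fm_bij).
  rewrite [LHS]surjective_pairing [RHS]surjective_pairing.
  congr pair; last exact: e.
  rewrite (fmor_fst_id (fiber_degE b)) (fmor_fst_id (fiber_degE b')).
  by rewrite !fiber_rE /= /slice2_v (fobj_fst_const x (fiber_r b) (fiber_r b')).
have [vinv _ Kv] := iso_v_bij phi.
have [v ev] := bij_surj Fo_bij (x, kr ga).
pose w := (vinv v).2.
have [mu emu] := bij_surj Fm_bij (kid (fobj F (iso_v phi (x, w))).1, ga).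
have d : kdeg mu = row_mx 0 (kdeg ga).
  by rewrite -F_deg emu /= /prod_deg /= kdeg_id.
have r : kr mu = iso_v phi (x, w).
  apply: (bij_inj Fo_bij); rewrite -fmor_r emu /= /prod_r /= kr_id.
  rewrite [RHS]surjective_pairing (fobj_snd_const w x (vinv v).1).
  by rewrite -surjective_pairing Kv ev.
have h : in_fiber (slice2 phi x) mu.
  by apply/in_fiberP; split; [exists (kdeg ga) | exists w].
by exists (to_fiber h); rewrite /fiber2_snd /= emu.
Qed.

Lemma fiber2_snd_hat x y (p : @gpath (skeleton L) x y) b :
  fiber2_snd (hatR p b) = fiber2_snd b.
Proof.
have [p' [c c' e _ _]] := hatR_square p b.
have := congr1 (fun mu => (fmor F mu).2) e; rewrite !fmor_comp //=.
rewrite (fmor_snd_id_s (pcomp_d (slice1 phi _) p)).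
rewrite (fmor_snd_id (pcomp_d (slice1 phi _) p')) c -c'.
by rewrite -fmor_s -fmor_r /= kcompm1 kcomp1m.
Qed.

Lemma walkR_snd
    (bij : forall e : gedge (skeleton L),
      bijective (hatR (phi := phi) (gpath1 e)))
    x y (xi : @gpath (double (skeleton L)) x y) b :
  fiber2_snd (walkR bij xi b) = fiber2_snd b.
Proof.
elim: xi b => [//|[e s] u xi IH] b /=; rewrite -[RHS]IH.
case: s xi {IH} => xi /=; first exact: fiber2_snd_hat.
by rewrite -[in RHS](bij_invK (bij e) (walkR bij xi b)) fiber2_snd_hat.
Qed.

Lemma morphic_relaxed_stable2 : relaxed_stable2 phi.
Proof.
have bij x y (p : @gpath (skeleton L) x y) : bijective (hatR (phi := phi) p).
  exact: bij_factor (fiber2_snd_bij x) (fiber2_snd_bij y) (fiber2_snd_hat p).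
exists bij => x y xi xi' b.
by apply: (bij_inj (fiber2_snd_bij x)); rewrite !walkR_snd.
Qed.

End Converse.
End Equivalence.

Lemma kiso_prod_iff_relaxed_stable k1 k2 (L : kgraph k1) (G : kgraph k2)
    (O : kgraph (k1 + k2)) (Q : quasi_product L G O) :
  connected (skeleton L) -> connected (skeleton G) ->
  kiso O (kprod L G) <->
  relaxed_stable1 (qp_iso Q) /\ relaxed_stable2 (qp_iso Q).
Proof.
move=> cL cG; split=> [[F [Fo Fm Fd]]|[st1 st2]].
  split; first exact: morphic_relaxed_stable1 cL cG _ Fo Fm Fd.
  exact: morphic_relaxed_stable2 cL cG _ Fo Fm Fd.
(* Omega is isomorphic to the product of the fibers at any pair of base vertices; these are the ones
   whose fibers are copies of [L] and [G]. *)
have [w0 iso1] := qp_fiber1 Q; have [x0 iso2] := qp_fiber2 Q.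
apply: kiso_trans (kiso_prod iso1 iso2).
exact: relaxed_stable_kiso cL cG w0 x0 st1 st2.
Qed.

End QuasiProductTheory.

Theorem theorem5p7 (k1 k2 : nat) (Lambda : kgraph k1) (Gamma : kgraph k2)
    (Omega : kgraph (k1 + k2)) (Q : quasi_product Lambda Gamma Omega)
    (connected_Lambda : connected (skeleton Lambda))
    (connected_Gamma : connected (skeleton Gamma)) :
  kiso Omega (kprod Lambda Gamma) <->
  relaxed_stable1 (qp_iso Q) /\ relaxed_stable2 (qp_iso Q).
Proof.
exact (QuasiProductTheory.kiso_prod_iff_relaxed_stable Q
  connected_Lambda connected_Gamma).
Qed.
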